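(* Let $\hat g(n;d)$ be the number of $r$-regular bipartite multigraphs on $(U,V)$ whose largest planar subgraph has at most $d$ edges. Then: (i) $\hat g(n;d)$ equals the number of ordered pairs $(P,Q)$ of standard Young tableaux of the same shape, both in $T([rn];d)$ and both satisfying Condition $(\hat T)$: for each $i\in[n]$ and $1\le s<r$, the row containing $r(i-1)+s+1$ is weakly above the row containing $r(i-1)+s$. (ii) $\hat g(n;d)=\sum_{\pi\in S_d}\operatorname{sgn}(\pi)\,|\widehat W'(d,2rn;T(\pi))|$, where $\widehat W'(d,2rn;T(\pi))$ is the set of walks in $W^*(d,2rn;T(\pi))$ with $a_{u^s}<a_{u^{s+1}}$ and $b_{v^s}<b_{v^{s+1}}$ for all $u\in U$, $v\in V$, $1\le s<r$.
   Context: Fix integers $n,r\ge 1$. Let $U=\{u_1,\dots,u_n\}$, $V=\{v_1,\dots,v_n\}$ be disjoint sets ordered by $u_1\prec\cdots\prec u_n$, $v_1\prec\cdots\prec v_n$. An $r$-regular bipartite multigraph on $(U,V)$ is a multiset of edges $uv$ ($u\in U,v\in V$) in which every vertex has degree $r$ (equivalently an $n\times n$ nonnegative integer matrix with all row and column sums $r$). A planar subgraph of such a multigraph $G$ is a sub-multiset of its edges (parallel copies counted separately) any two of which, $uv$ and $u'v'$, satisfy ($u\preceq u'$ and $v\preceq v'$) or ($u'\preceq u$ and $v'\preceq v$); i.e., a set of non-crossing edges which may share endpoints. $T([m];d)$ denotes the set of standard Young tableaux whose entries are exactly $1,\dots,m$ and which have at most $d$ columns (rows are numbered from top to bottom, row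 $i$ above row $i+1$). Walks: a walk of length $2m$ in $\mathbb Z^d$ from the origin whose first $m$ steps are positive and last $m$ steps negative is written $a_1\cdots a_m|b_1\cdots b_m$, $a_i,b_i\in[d]$, with steps $e_{a_1},\dots,e_{a_m},-e_{b_1},\dots,-e_{b_m}$; $W^*(d,2m;P)$ is the set of such walks ending in $P$. With $m=rn$, write $a_{u_i^s}=a_{r(i-1)+s}$ and $b_{v_i^s}=b_{r(i-1)+s}$. For a permutation $\pi$ of $[d]$, $T(\pi)=(1-\pi(1),\dots,d-\pi(d))$. *)

(* Defs.v *)
From mathcomp Require Import all_boot all_order all_algebra all_fingroup.
Set Implicit Arguments. Unset Strict Implicit. Unset Printing Implicit Defensive.
Import GRing.Theory Num.Theory.

(* ---------- r-regular bipartite multigraphs on (U,V), |U|=|V|=n ----------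
   A multigraph is an n x n matrix of edge multiplicities; u_i is row i,
   v_j is column j (0-based), with the order u_1 < ... < u_n being the index
   order.  In an r-regular multigraph every multiplicity is <= r, so the
   entries are taken in 'I_r.+1 (this only makes the type finite). *)

Definition mult (r n : nat) (M : 'M['I_r.+1]_n) (i j : 'I_n) : nat := M i j.

Definition regular (r n : nat) (M : 'M['I_r.+1]_n) : bool :=
  [forall i, \sum_j mult M i j == r] && [forall j, \sum_i mult M i j == r].

Definition submult (r n : nat) (S M : 'M['I_r.+1]_n) : bool :=
  [forall i, forall j, mult S i j <= mult M i j].

Definition planar (r n : nat) (S : 'M['I_r.+1]_n) : bool :=
  [forall i, forall j, forall i', forall j',
     ((0 < mult S i j) && (0 < mult S i' j')) ==>
     (((i <= i') && (j <= j')) || ((i' <= i) && (j' <= j)))%N].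

Definition nedges (r n : nat) (S : 'M['I_r.+1]_n) : nat := \sum_i \sum_j mult S i j.

Definition maxplanar_le (r n d : nat) (M : 'M['I_r.+1]_n) : bool :=
  [forall S : 'M['I_r.+1]_n, (submult S M && planar S) ==> (nedges S <= d)].

Definition ghat (r n d : nat) : nat :=
  #|[set M : 'M['I_r.+1]_n | regular M && maxplanar_le d M]|.

(* ---------- standard Young tableaux ----------
   A tableau is the list of its rows, top row first. *)
Definition is_syt (m d : nat) (t : seq (seq nat)) : bool :=
  [&& all (fun row => 0 < size row) t,
      sorted geq (map size t),
      all (sorted ltn) t,
      all (fun i => all (fun j => nth 0 (nth [::] t i) j < nth 0 (nth [::] t i.+1) j)
                        (iota 0 (size (nth [::] t i.+1))))
          (iota 0 (size t).-1),
      perm_eq (flatten t) (iota 1 m)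
    & all (fun row => size row <= d) t].

Definition rowof (t : seq (seq nat)) (k : nat) : nat := find (fun row => k \in row) t.

(* Condition (T^): for i in [n], 1 <= s < r, with k = r(i-1)+s, the row of
   k+1 is weakly above (index <=) the row of k.  Such k are exactly the
   k with 1 <= k < r n and k %% r != 0. *)
Definition condThat (r n : nat) (t : seq (seq nat)) : bool :=
  all (fun k => (k %% r != 0) ==> (rowof t k.+1 <= rowof t k)) (iota 1 (r * n).-1).

Definition tabpair_ok (r n d : nat) (PQ : seq (seq nat) * seq (seq nat)) : bool :=
  [&& is_syt (r * n) d PQ.1, is_syt (r * n) d PQ.2,
      map size PQ.1 == map size PQ.2, condThat r n PQ.1 & condThat r n PQ.2].

(* ---------- walks ----------
   A walk a_1..a_m | b_1..b_m with a_i, b_i in [d] is a pair of functions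
   'I_m -> 'I_d (0-based: step value k stands for direction e_{k+1}). *)
Definition walk (m d : nat) := ({ffun 'I_m -> 'I_d} * {ffun 'I_m -> 'I_d})%type.

Definition endpt (m d : nat) (w : walk m d) (k : 'I_d) : int :=
  (#|[set i | w.1 i == k]|)%:Z - (#|[set i | w.2 i == k]|)%:Z.

(* T(pi) = (1 - pi(1), ..., d - pi(d)); 0-based coordinate k: k - pi k *)
Definition Tpi (d : nat) (pi : 'S_d) (k : 'I_d) : int := (k : nat)%:Z - (pi k : nat)%:Z.

(* a_{u^s} < a_{u^{s+1}} and b_{v^s} < b_{v^{s+1}}: with 0-based position p,
   p and p+1 belong to the same vertex iff (p+1) %% r != 0 *)
Definition hat_incr (r n d : nat) (w : walk (r * n) d) : bool :=
  [forall p : 'I_(r * n), forall q : 'I_(r * n),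
     ((q == p.+1 :> nat) && (p.+1 %% r != 0)) ==>
     ((w.1 p < w.1 q)%N && (w.2 p < w.2 q)%N)].

Definition What' (r n d : nat) (P : 'I_d -> int) : {set walk (r * n) d} :=
  [set w | [forall k, endpt w k == P k] && hat_incr w].

(* Main.v *)
(* All three counts are compared with the set of pairs (s1, s2) of sequences of
   n subsets of [d], each of size r, such that every prefix of s1 and of s2 has
   weakly decreasing content, and s1 and s2 have the same total content.
   - Multigraphs: Fomin's growth diagram turns a matrix into two chains of
     partitions with the same last term, each step adding a horizontal strip of
     size r; the first row of the last partition obeys the last-passage
     recursion, hence is the size of a largest planar subgraph.  A horizontal
     strip is recorded by the set of columns that it meets.
   - Walks: the condition within a vertex says that a block of r steps lists a
     subset of [d] in increasing order.  Blockwise steps preserve antisymmetric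
     functions, and a block leaving the open Weyl chamber lands on a wall, where
     such functions vanish, so that the signed sum only sees chamber walks.
   - Tableaux: the word of the columns of 1, ..., rn is a ballot word, and the
     condition on rows says that it increases strictly within blocks; the words
     of rows and columns determine each other by counting earlier equal letters. *)

Require Import Defs.
From mathcomp Require Import all_boot all_order all_algebra all_fingroup.
From mathcomp Require Import zify.
Import GRing.Theory Num.Theory.
Set Implicit Arguments.
Unset Strict Implicit.
Unset Printing Implicit Defensive.

(** * Weakly decreasing functions and counting by bijection *)

Definition antitone (f : nat -> nat) := forall k, f k.+1 <= f k.

Lemma antitone_le f k l : antitone f -> k <= l -> f l <= f k.
Proof.
move=> anti_f /subnK <-; elim: (l - k) => // i IH.
exact: leq_trans (anti_f _) IH.
Qed.

Lemma size_bij (T1 T2 : eqType) (f : T1 -> T2) (s1 : seq T1) (s2 : seq T2) :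
    uniq s1 -> uniq s2 -> {in s1 &, injective f} ->
    {in s1, forall x, f x \in s2} -> {in s2, forall y, exists2 x, x \in s1 & f x = y} ->
  size s1 = size s2.
Proof.
move=> us1 us2 injf f12 f21; rewrite -(size_map f).
apply: perm_size; apply: uniq_perm; rewrite ?map_inj_in_uniq // => y.
by apply/mapP/idP => [[x xs1 ->]|/f21[x]]; [apply: f12 | exists x].
Qed.

(** * Families of subsets and their column words *)

Section Families.

Variable d : nat.
Implicit Types (S : {set 'I_d}) (s : seq {set 'I_d}).

(** Letters are naturals rather than ordinals, so that column words and row words of tableaux share
    one type. *)
Definition blk S : seq nat := [seq val x | x <- enum S].

(* The column word: the elements of each block, listed in increasing order. *)
Definition wd s : seq nat := flatten (map blk s).

Lemma mem_blk S (x : 'I_d) : (val x \in blk S) = (x \in S).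
Proof. by rewrite mem_map ?mem_enum //; apply: val_inj. Qed.

Lemma blk_lt S c : c \in blk S -> c < d.
Proof. by case/mapP => x _ ->; apply: ltn_ord. Qed.

Lemma sorted_blk S : sorted ltn (blk S).
Proof.
apply: (@subseq_sorted _ _ ltn_trans _ (map val (enum 'I_d))).
  apply: map_subseq; rewrite [enum 'I_d]enumT /enum_mem. exact: filter_subseq.
by rewrite val_enum_ord iota_ltn_sorted.
Qed.

Lemma uniq_blk S : uniq (blk S).
Proof. by rewrite map_inj_uniq ?enum_uniq //; apply: val_inj. Qed.

Lemma size_blk S : size (blk S) = #|S|.
Proof. by rewrite size_map -cardE. Qed.

Lemma blk_inj : injective blk.
Proof. by move=> S S' eqS; apply/setP => x; rewrite -!mem_blk eqS. Qed.

Lemma count_blk S c : count_mem c (blk S) = (c \in blk S).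
Proof. by rewrite count_uniq_mem ?uniq_blk. Qed.

Lemma wd_cons S s : wd (S :: s) = blk S ++ wd s. Proof. by []. Qed.

Lemma wd_rcons s S : wd (rcons s S) = wd s ++ blk S.
Proof. by rewrite /wd map_rcons flatten_rcons. Qed.

Lemma count_wd_rcons s S c :
  count_mem c (wd (rcons s S)) = count_mem c (wd s) + (c \in blk S).
Proof. by rewrite wd_rcons count_cat count_blk. Qed.

Lemma wd_lt s c : c \in wd s -> c < d.
Proof. by case/flatten_mapP => S _ /blk_lt. Qed.

Lemma count_wd_size s c : count_mem c (wd s) <= size s.
Proof.
elim: s => //= S s IH; rewrite wd_cons count_cat count_blk.
by rewrite -add1n leq_add // leq_b1.
Qed.

Definition fam (r n : nat) s := (size s == n) && all (fun B : {set 'I_d} => #|B| == r) s.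

Definition dominant s := antitone (fun c => count_mem c (wd s)).

(** Bounding both quantifiers makes this a boolean. Nothing is lost: letters from [d] on do not
    occur, and longer prefixes equal [s]. *)
Definition chamber s :=
  all (fun i => all (fun c => count_mem c.+1 (wd (take i s)) <= count_mem c (wd (take i s)))
                    (iota 0 d)) (iota 0 (size s).+1).

Lemma chamberP s : reflect (forall i, dominant (take i s)) (chamber s).
Proof.
apply: (iffP allP) => [ch i c | ch i _]; last by apply/allP => c _; apply: ch.
have [c_d | d_c] := ltnP c d; last first.
  rewrite (count_memPn _) //; apply/negP => /wd_lt; lia.
have [i_s|s_i] := leqP i (size s).
  by apply: (allP (ch i _)); rewrite mem_iota.
rewrite take_oversize ?(ltnW s_i) //; have := ch (size s).
by rewrite mem_iota take_size ltnS leqnn => /(_ isT)/allP; apply; rewrite mem_iota.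
Qed.

Lemma chamber_dominant s : chamber s -> dominant s.
Proof. by move/chamberP/(_ (size s)); rewrite take_size. Qed.

Lemma chamber_rcons s S : chamber (rcons s S) <-> chamber s /\ dominant (rcons s S).
Proof.
split=> [ch | [/chamberP ch wt]].
  split; last exact: chamber_dominant.
  apply/chamberP => i; have [i_s|s_i] := leqP i (size s).
    by move/chamberP/(_ i): ch; rewrite -cats1 takel_cat.
  move/chamberP/(_ (size s)): ch; rewrite -cats1 take_size_cat //.
  by rewrite take_oversize // ltnW.
apply/chamberP => i; have [i_s|s_i] := leqP i (size s).
  by rewrite -cats1 takel_cat.
by rewrite take_oversize ?size_rcons.
Qed.

Section Enumeration.

Variable r : nat.

(** New blocks go to the right end, because the reflection argument peels off the last step of a
    walk. *)
Fixpoint fams n : seq (seq {set 'I_d}) :=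
  if n is n'.+1 then
    [seq rcons s B | s <- fams n', B <- enum [set B : {set 'I_d} | #|B| == r]]
  else [:: [::]].

Lemma mem_fams n s : (s \in fams n) = fam r n s.
Proof.
elim: n s => [|n IH] s; first by case: s.
apply/allpairsP/idP => /= [[[s' S] /= [s'n]]|].
  rewrite mem_enum inE IH in s'n * => cS ->.
  by rewrite /fam size_rcons all_rcons cS eqSS.
case/lastP: s => [|s S]; first by case/andP.
rewrite /fam size_rcons all_rcons eqSS => /and3P[sn cS sr].
by exists (s, S); split; rewrite //= ?mem_enum ?inE // IH /fam sn.
Qed.

Lemma uniq_fams n : uniq (fams n).
Proof.
elim: n => // n IH; apply: allpairs_uniq => //; first exact: enum_uniq.
by move=> [s S] [s' S'] _ _ /= /rcons_inj.
Qed.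

End Enumeration.
End Families.

(** * The reflection principle for blockwise steps *)

Section Reflection.

Variables d r : nat.

Local Open Scope ring_scope.

(** The relation between [y] and [y'] is pointwise, so that no functional extensionality is needed;
    [sigma = 1] gives invariance under [=1]. *)
Definition antisym (F : ('I_d -> int) -> int) :=
  forall y y' (sigma : 'S_d), (forall c, y' c = y (sigma c)) ->
    F y' = (-1) ^+ sigma * F y.

Lemma antisym_ext F y y' : antisym F -> y =1 y' -> F y = F y'.
Proof.
move=> asF eqy; rewrite (asF y' y 1%g) ?odd_perm1 ?mul1r // => c.
by rewrite perm1.
Qed.

Lemma antisym_eq0 F y (a b : 'I_d) : antisym F -> a != b -> y a = y b -> F y = 0.
Proof.
move=> asF ab yab; have: F y = (-1) ^+ tperm a b * F y.
  by apply: asF => c; case: tpermP => [->|->|].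
by rewrite odd_tperm ab expr1; lia.
Qed.

Definition addset (y : 'I_d -> int) (B : {set 'I_d}) c := y c + (c \in B)%:Z.

Definition upsum (F : ('I_d -> int) -> int) y :=
  \sum_(B <- enum [set B : {set 'I_d} | #|B| == r]) F (addset y B).

(** Permuting the coordinates merely permutes the [r]-subsets that are summed over, here by taking
    preimages under [sigma]. *)
Lemma antisym_upsum F : antisym F -> antisym (upsum F).
Proof.
move=> asF y y' sigma y'E; rewrite /upsum big_distrr /= !big_enum /=.
rewrite (reindex_inj (h := fun B : {set 'I_d} => sigma @^-1: B)) /=; last first.
  move=> B B' /setP eqB; apply/setP => c; move: (eqB (sigma^-1 c)%g).
  by rewrite !inE permKV.
apply: eq_big => [B | B _]; last first.
  by apply: asF => c; rewrite /addset y'E inE.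
by rewrite !inE card_preimset //; apply: perm_inj.
Qed.

(* The walk starts at (0, -1, ..., 1 - d), so that the chamber condition
   becomes strict decrease of the coordinates. *)
Definition pos (s : seq {set 'I_d}) (c : 'I_d) : int :=
  (count_mem (val c) (wd s))%:Z - (val c)%:Z.

Lemma pos_rcons s B c : pos (rcons s B) c = addset (pos s) B c.
Proof. by rewrite /pos /addset count_wd_rcons mem_blk PoszD addrAC. Qed.

Lemma dominant_pos s (a b : 'I_d) : dominant s -> (a < b)%N -> pos s b < pos s a.
Proof. by move=> /antitone_le wt ab; move: (wt _ _ (ltnW ab)); rewrite /pos /=; lia. Qed.

(* A step out of the chamber creates two equal coordinates, where F vanishes. *)
Lemma sum_chamber n F : antisym F ->
  \sum_(s <- fams d r n) F (pos s) = \sum_(s <- fams d r n | chamber s) F (pos s).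
Proof.
elim: n F => [|n IH] F asF.
  have ch0 : chamber ([::] : seq {set 'I_d}) by apply/chamberP => i c.
  by rewrite [RHS]big_mkcond !big_seq1 ch0.
rewrite [RHS]big_mkcond /= !big_allpairs_dep /=.
(* Summing over the last block replaces [F] by [upsum F], which is again antisymmetric, so the
   induction hypothesis applies to it. *)
transitivity (\sum_(s <- fams d r n) upsum F (pos s)).
  apply: eq_bigr => s _; apply: eq_bigr => B _.
  by apply: antisym_ext => // c; rewrite pos_rcons.
rewrite IH; last exact: antisym_upsum.
rewrite big_mkcond; apply: eq_bigr => s _; case: ifP => [ch_s|nch_s].
  apply: eq_bigr => B _; rewrite -(antisym_ext asF (pos_rcons s B)).
  (* If [c.+1] overtakes [c], then the two counts were equal before and [B] contains only [c.+1] of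
     the two. The new counts differ by one, which the shift in [pos] cancels. *)
  case: ifP => // /negP nch; case: (pickP (fun c : 'I_d =>
      count_mem (val c) (wd (rcons s B)) < count_mem (val c).+1 (wd (rcons s B)))%N).
    move=> c lt_c; have := chamber_dominant ch_s c.
    move: (lt_c); rewrite /= !count_wd_rcons => lt_c' le_c.
    have cB : (val c).+1 \in blk B by case: (_.+1 \in blk B) lt_c' => //=; lia.
    pose c' := Ordinal (blk_lt cB).
    apply: (@antisym_eq0 _ _ c c') => //; first by rewrite neq_ltn /= ltnSn.
    rewrite /pos (erefl : val c' = (val c).+1) !count_wd_rcons.
    by move: lt_c' le_c; rewrite cB /=; case: (_ \in blk B) => /=; lia.
  move=> nex; case: nch; apply/chamber_rcons; split=> // c.
  have [c_d|d_c] := ltnP c d; first by rewrite leqNgt (nex (Ordinal c_d)).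
  by rewrite (count_memPn _) //; apply/negP => /wd_lt; lia.
rewrite big1 // => B _; case: ifP => // /chamber_rcons[]; by rewrite nch_s.
Qed.

(** This is the determinant of the 0/1 matrix with entries [x c == y c'], an antisymmetric
    substitute for the indicator of [x = y]. *)
Definition kernel (x y : 'I_d -> int) : int :=
  \sum_(pi : 'S_d) (-1) ^+ pi * [forall c, x c == y (pi c)]%:Z.

Lemma antisym_kernelr x : antisym (kernel x).
Proof.
move=> y y' sigma y'E; rewrite /kernel big_distrr /=.
rewrite [RHS](reindex_inj (mulIg sigma)) /=; apply: eq_bigr => pi _.
rewrite odd_permM signr_addb [X in _ * (X * _)]mulrC -mulrA signrMK; congr (_ * _); congr (nat_of_bool _)%:Z.
by apply: eq_forallb => c; rewrite permM y'E.
Qed.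

Lemma antisym_kernell y : antisym (kernel^~ y).
Proof.
move=> x x' sigma x'E; rewrite /kernel big_distrr /=.
rewrite (reindex_inj (mulgI sigma)) /=; apply: eq_bigr => pi _.
rewrite odd_permM signr_addb mulrA; congr (_ * _); congr (nat_of_bool _)%:Z.
apply/forallP/forallP => eqx c; last by rewrite permM x'E.
by move: (eqx (sigma^-1 c)%g); rewrite permM x'E permKV.
Qed.

(** An increasing permutation moves no point down, and neither does its inverse, which is increasing
    too. *)
Lemma perm_mono_eq1 (pi : 'S_d) : (forall a b : 'I_d, a < b -> pi a < pi b)%N -> pi = 1%g.
Proof.
move=> mono_pi.
have le_pi (sigma : 'S_d) :
    (forall a b : 'I_d, a < b -> sigma a < sigma b)%N -> forall c : 'I_d, (c <= sigma c)%N.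
  move=> mono [c c_d] /=; elim: c c_d => // c IH c_d.
  have c_d' : (c < d)%N by apply: ltnW.
  by apply: leq_ltn_trans (IH c_d') _; apply: mono.
apply/permP => c; rewrite perm1; apply/val_inj/eqP; rewrite eqn_leq le_pi // andbT.
have: (pi c <= pi^-1%g (pi c))%N; last by rewrite permK.
apply: le_pi => a b ab; rewrite ltnNge leq_eqVlt negb_or; apply/andP; split.
  apply/eqP => /val_inj/perm_inj eqab; by rewrite eqab ltnn in ab.
by apply/negP => /mono_pi; rewrite !permKV; lia.
Qed.

(** A nonzero term needs [x c = y (pi c)] for all [c]; as both points are strictly decreasing, [pi]
    is then increasing, hence the identity. *)
Lemma kernel_chamber x y :
    (forall a b : 'I_d, (a < b)%N -> x b < x a) ->
    (forall a b : 'I_d, (a < b)%N -> y b < y a) ->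
  kernel x y = [forall c, x c == y c]%:Z.
Proof.
move=> x_dec y_dec; rewrite /kernel (bigD1 1%g) //= big1 => [|pi pi1].
  rewrite odd_perm1 mul1r addr0; congr (nat_of_bool _)%:Z.
  by apply: eq_forallb => c; rewrite perm1.
case: forallP => [eqxy|_]; last by rewrite mulr0.
case/eqP: pi1; apply: perm_mono_eq1 => a b ab.
move: (x_dec _ _ ab); rewrite (eqP (eqxy a)) (eqP (eqxy b)).
by case: ltngtP => // [/y_dec|/val_inj->]; lia.
Qed.

Definition imfam (pi : 'S_d) : seq {set 'I_d} -> seq {set 'I_d} :=
  map (fun B : {set 'I_d} => pi @: B).

Lemma perm_imfam pi n : perm_eq (map (imfam pi) (fams d r n)) (fams d r n).
Proof.
have imK (sigma : 'S_d) : cancel (imfam sigma) (imfam sigma^-1).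
  move=> s; rewrite /imfam -map_comp map_id_in // => B _ /=.
  rewrite -imset_comp; rewrite -[RHS]imset_id; apply: eq_imset => c.
  by rewrite /= permK.
have fam_im (sigma : 'S_d) s : s \in fams d r n -> imfam sigma s \in fams d r n.
  rewrite !mem_fams /fam size_map all_map => /andP[-> /allP cs]; apply/allP => B /cs /=.
  by rewrite card_imset //; apply: perm_inj.
apply: uniq_perm => [||s]; rewrite ?map_inj_uniq ?uniq_fams //.
  exact: can_inj (imK pi).
apply/mapP/idP => [[s' s'F ->]|sF]; first exact: fam_im.
by exists (imfam pi^-1 s); rewrite ?fam_im //; move: (imK pi^-1%g s); rewrite invgK.
Qed.

Lemma count_imfam (pi : 'S_d) s (c : 'I_d) :
  count_mem (val (pi c)) (wd (imfam pi s)) = count_mem (val c) (wd s).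
Proof.
elim: s => //= B s IH; rewrite !wd_cons !count_cat IH !count_blk !mem_blk.
by rewrite mem_imset //; apply: perm_inj.
Qed.

Definition fampairs n := [seq (s1, s2) | s1 <- fams d r n, s2 <- fams d r n].

Definition same_content (ss : seq {set 'I_d} * seq {set 'I_d}) :=
  [forall c : 'I_d, count_mem (val c) (wd ss.1) == count_mem (val c) (wd ss.2)].

Definition end_at (P : 'I_d -> int) (ss : seq {set 'I_d} * seq {set 'I_d}) :=
  [forall c : 'I_d,
     (count_mem (val c) (wd ss.1))%:Z - (count_mem (val c) (wd ss.2))%:Z == P c].

Lemma count_allpairs_sum (T1 T2 : Type) (s1 : seq T1) (s2 : seq T2) (a : pred (T1 * T2)) :
  (count a [seq (x, y) | x <- s1, y <- s2])%:Z = \sum_(x <- s1) \sum_(y <- s2) (a (x, y))%:Z.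
Proof.
rewrite -sum1_count -natz natr_sum big_mkcond big_allpairs_dep /=.
by apply: eq_bigr => x _; apply: eq_bigr => y _; case: (a _).
Qed.

(** The signed count is a double sum of [kernel (pos s1) (pos s2)]. Antisymmetry in each argument
    restricts both sums to chamber families, where the kernel tests equality of positions, that is,
    of contents. *)
Lemma reflection n :
  \sum_(pi : 'S_d) (-1) ^+ pi * (count (end_at (Tpi pi)) (fampairs n))%:Z
  = (size [seq ss <- fampairs n | [&& chamber ss.1, chamber ss.2 & same_content ss]])%:Z.
Proof.
transitivity (\sum_(s1 <- fams d r n) \sum_(s2 <- fams d r n) kernel (pos s1) (pos s2)).
  under [RHS]eq_bigr do rewrite exchange_big /=.
  rewrite exchange_big /=; apply: eq_bigr => pi _.
  rewrite count_allpairs_sum big_distrr /=; apply: eq_bigr => s1 _.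
  (* Renaming the letters of [s2] by [pi] turns [pos s1 c == pos s2 (pi c)] into a difference of
     contents equal to [c - pi c], the coordinate of [Tpi pi]. *)
  rewrite big_distrr /= -[RHS](perm_big _ (perm_imfam pi n)) big_map.
  apply: eq_bigr => s2 _; congr (_ * (nat_of_bool _)%:Z).
  apply: eq_forallb => c; rewrite /pos count_imfam /Tpi /=; lia.
rewrite size_filter count_allpairs_sum /=.
rewrite (sum_chamber n (F := fun x => \sum_(s2 <- fams d r n) kernel x (pos s2))); last first.
  move=> y y' sigma y'E; rewrite big_distrr /=; apply: eq_bigr => s2 _.
  exact: antisym_kernell.
rewrite big_mkcond; apply: eq_bigr => s1 _; case: ifP => [ch1|]; last by rewrite big1.
rewrite (sum_chamber n (antisym_kernelr (pos s1))).
rewrite big_mkcond; apply: eq_bigr => s2 _; case: ifP => //= ch2.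
rewrite kernel_chamber; try by move=> a b; apply/dominant_pos/chamber_dominant.
by congr (nat_of_bool _)%:Z; apply: eq_forallb => c; rewrite /pos /=; lia.
Qed.
End Reflection.

(** * Walks and families, compared through words *)

Lemma size_eq_map (T1 T2 T : eqType) (f1 : T1 -> T) (f2 : T2 -> T) (s1 : seq T1) (s2 : seq T2) :
    uniq s1 -> uniq s2 -> {in s1 &, injective f1} -> {in s2 &, injective f2} ->
    {in s1, forall x, exists2 y, y \in s2 & f2 y = f1 x} ->
    {in s2, forall y, exists2 x, x \in s1 & f1 x = f2 y} ->
  size s1 = size s2.
Proof.
move=> us1 us2 inj1 inj2 f12 f21; rewrite -(size_map f1) -(size_map f2).
apply: perm_size; apply: uniq_perm; rewrite ?map_inj_in_uniq // => z.
apply/mapP/mapP => [[x xs1 ->]|[y ys2 ->]].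
  by have [y ys2 <-] := f12 x xs1; exists y.
by have [x xs1 <-] := f21 y ys2; exists x.
Qed.

Section Words.

Variables r d : nat.

Definition incr (w : seq nat) :=
  forall p, p.+1 < size w -> p.+1 %% r != 0 -> nth 0 w p < nth 0 w p.+1.

Implicit Type s : seq {set 'I_d}.

Lemma fam_cons n (B : {set 'I_d}) s : fam r n.+1 (B :: s) = (#|B| == r) && fam r n s.
Proof. by rewrite /fam /= eqSS andbCA. Qed.

Lemma size_wd n s : fam r n s -> size (wd s) = n * r.
Proof.
elim: s n => [|B s IH] [|n] //; rewrite fam_cons => /andP[/eqP cB sn].
by rewrite wd_cons size_cat size_blk cB (IH n).
Qed.

Lemma wd_incr n s : fam r n s -> incr (wd s).
Proof.
elim: s n => [|B s IH] [|n] //; rewrite fam_cons => /andP[/eqP cB sn] p.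
rewrite wd_cons !nth_cat size_cat size_blk cB => p_lt pr.
(* Either both positions lie in the first block, or [p] is its last position, which [pr] excludes,
   or both lie in later blocks. *)
have [p1_r|r_p1] := ltnP p.+1 r.
  rewrite (ltnW p1_r); apply: (sortedP 0 (sorted_blk B)).
  by rewrite size_blk cB.
have [p_r|r_p] := ltnP p r.
  by have p1E: p.+1 = r; [lia | rewrite p1E modnn in pr].
rewrite subSn //; apply: (IH n sn).
  by lia.
by rewrite -subSn // -(modnDr (p.+1 - r)) subnK.
Qed.

Lemma wd_inj n s s' : fam r n s -> fam r n s' -> wd s = wd s' -> s = s'.
Proof.
elim: s s' n => [|B s IH] [|B' s'] [|n] //.
rewrite !fam_cons => /andP[/eqP cB sn] /andP[/eqP cB' sn'].
rewrite !wd_cons => /eqP; rewrite eqseq_cat ?size_blk ?cB ?cB' //.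
by case/andP => /eqP/blk_inj-> /eqP/(IH _ _ sn sn')->.
Qed.

(** The first [r] letters increase strictly, hence are the sorted listing of the set that they form;
    the rest follows by induction. *)
Lemma incr_wd n (w : seq nat) :
    size w = n * r -> incr w -> {in w, forall c, c < d} ->
  exists2 s : seq {set 'I_d}, fam r n s & wd s = w.
Proof.
elim: n w => [|n IH] w sz_w incr_w w_d.
  by exists [::] => //; case: w sz_w {incr_w w_d}.
have r_w : r <= size w by rewrite sz_w mulSn leq_addr.
have sz_t : size (take r w) = r by rewrite size_takel.
have [|p p_lt pr|c cw|s sn sw] := IH (drop r w).
- by rewrite size_drop sz_w mulSn addKn.
- rewrite !nth_drop addnS; apply: incr_w.
    by move: p_lt; rewrite size_drop; lia.
  by rewrite -addnS addnC modnDr.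
- by apply: w_d; apply: mem_drop cw.
have sorted_t : sorted ltn (take r w).
  apply/(sortedP 0) => p; rewrite sz_t => p1_r.
  rewrite !nth_take ?(ltnW p1_r) //; apply: incr_w; first by apply: leq_trans p1_r r_w.
  by rewrite modn_small.
pose B := [set c : 'I_d | val c \in take r w].
have blkB : blk B = take r w.
  apply: (irr_sorted_eq ltn_trans ltnn (sorted_blk B) sorted_t) => c.
  apply/idP/idP => [cB|cw].
    have:= cB; rewrite -[c]/(val (Ordinal (blk_lt cB))) mem_blk inE //.
  by rewrite -[c]/(val (Ordinal (w_d _ (mem_take cw)))) mem_blk inE.
exists (B :: s); last by rewrite wd_cons blkB sw cat_take_drop.
by rewrite fam_cons sn andbT -size_blk blkB sz_t.
Qed.

Definition ffun_word m (a : {ffun 'I_m -> 'I_d}) : seq nat := [seq val c | c <- codom a].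

Lemma size_ffun_word m (a : {ffun 'I_m -> 'I_d}) : size (ffun_word a) = m.
Proof. by rewrite size_map size_codom card_ord. Qed.

Lemma nth_ffun_word m (a : {ffun 'I_m -> 'I_d}) (p : 'I_m) : nth 0 (ffun_word a) p = a p.
Proof.
rewrite (nth_map (a p)) ?size_codom ?card_ord //.
by rewrite codomE (nth_map p) ?size_enum_ord // nth_ord_enum.
Qed.

Lemma ffun_word_inj m : injective (@ffun_word m).
Proof.
by move=> a b eqw; apply/ffunP => p; apply: val_inj; rewrite /= -!nth_ffun_word eqw.
Qed.

Lemma count_ffun_word m (a : {ffun 'I_m -> 'I_d}) (c : 'I_d) :
  count_mem (val c) (ffun_word a) = #|[set i | a i == c]|.
Proof.
rewrite /ffun_word count_map codomE count_map cardsE cardE enumT size_filter.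
by rewrite -enumT; apply: eq_count => i.
Qed.

Lemma word_ffun m (w : seq nat) : size w = m -> {in w, forall c, c < d} ->
  exists a : {ffun 'I_m -> 'I_d}, ffun_word a = w.
Proof.
move=> sz_w w_d.
have w_lt (p : 'I_m) : nth 0 w p < d by rewrite w_d // mem_nth ?sz_w.
exists [ffun p => Ordinal (w_lt p)]; apply: (@eq_from_nth _ 0).
  by rewrite size_ffun_word.
rewrite size_ffun_word => p p_m.
by rewrite -[p]/(val (Ordinal p_m)) nth_ffun_word ffunE.
Qed.

Lemma hat_incrP n (w : walk (r * n) d) :
  reflect (incr (ffun_word w.1) /\ incr (ffun_word w.2)) (hat_incr w).
Proof.
apply: (iffP forallP) => [inc|[inc1 inc2] p].
  suff inc' p : p.+1 < r * n -> p.+1 %% r != 0 ->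
    nth 0 (ffun_word w.1) p < nth 0 (ffun_word w.1) p.+1 /\
    nth 0 (ffun_word w.2) p < nth 0 (ffun_word w.2) p.+1.
    by split=> p; rewrite size_ffun_word => /inc' + /[dup]pr => /(_ pr)[].
  move=> p1_lt pr; have/forallP/(_ (Ordinal p1_lt))/implyP := inc (Ordinal (ltnW p1_lt)).
  by rewrite /= eqxx -!nth_ffun_word => /(_ pr)/andP.
apply/forallP => q; apply/implyP => /andP[/eqP qE pr].
by rewrite -!nth_ffun_word qE inc1 ?inc2 // size_ffun_word -qE.
Qed.

(** Both sides have the same image in pairs of words: those with letters below [d], increasing
    within blocks, whose letter counts differ by [P]. *)
Lemma card_What n (P : 'I_d -> int) : #|What' r n P| = count (end_at P) (fampairs d r n).
Proof.
rewrite cardE -size_filter.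
pose wd2 (ss : seq {set 'I_d} * seq {set 'I_d}) := (wd ss.1, wd ss.2).
apply: (size_eq_map (f1 := fun w => (ffun_word w.1, ffun_word w.2)) (f2 := wd2)).
- exact: enum_uniq.
- by rewrite filter_uniq // allpairs_uniq ?uniq_fams // => -[? ?] [? ?] _ _ [-> ->].
- by move=> [a b] [a' b'] _ _ [/ffun_word_inj-> /ffun_word_inj->].
- move=> ss ss'; rewrite !mem_filter => /andP[_ /allpairsP[[s1 s2] /= [s1F s2F ->]]].
  move=> /andP[_ /allpairsP[[s1' s2'] /= [s1F' s2F' ->]]] [].
  rewrite !mem_fams in s1F s2F s1F' s2F'.
  by move=> /(wd_inj s1F s1F')-> /(wd_inj s2F s2F')->.
- move=> [a b]; rewrite mem_enum inE => /andP[/forallP Pw /hat_incrP[/= inca incb]].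
  have ltw (c : {ffun 'I_(r * n) -> 'I_d}) : {in ffun_word c, forall x, x < d}.
    by move=> x /mapP[y _ ->]; apply: ltn_ord.
  have [|s1 s1F s1E] := @incr_wd n (ffun_word a) _ inca (@ltw a).
    by rewrite size_ffun_word mulnC.
  have [|s2 s2F s2E] := @incr_wd n (ffun_word b) _ incb (@ltw b).
    by rewrite size_ffun_word mulnC.
  exists (s1, s2); last by rewrite /wd2 s1E s2E.
  rewrite mem_filter; apply/andP; split.
    by apply/forallP => c; rewrite s1E s2E !count_ffun_word; apply: Pw.
  by apply/allpairsP; exists (s1, s2); rewrite !mem_fams.
move=> ss; rewrite mem_filter => /andP[/forallP Pss /allpairsP[[s1 s2] /= [s1F s2F ssE]]].
rewrite !{ss}ssE /wd2 !mem_fams /= in s1F s2F Pss *.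
have [a aE] : exists a : {ffun 'I_(r * n) -> 'I_d}, ffun_word a = wd s1.
  by apply: word_ffun => [|c /wd_lt//]; rewrite (size_wd s1F) mulnC.
have [b bE] : exists b : {ffun 'I_(r * n) -> 'I_d}, ffun_word b = wd s2.
  by apply: word_ffun => [|c /wd_lt//]; rewrite (size_wd s2F) mulnC.
exists (a, b); last by rewrite aE bE.
rewrite mem_enum inE; apply/andP; split.
  by apply/forallP => c; rewrite /endpt -!count_ffun_word aE bE; apply: Pss.
by apply/hat_incrP; rewrite aE bE; split; apply: wd_incr; eassumption.
Qed.

End Words.

(** * Transposition of partitions *)

(* Column lengths of the partition with row lengths [f 0, ..., f N.-1]. *)
Definition cj N (f : nat -> nat) c := \sum_(k < N) (c < f k).

Lemma cj_antitone N f : antitone (cj N f).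
Proof. by move=> c; apply: leq_sum => k _; case: ltnP => // /ltnW->. Qed.

Lemma cj_le N f c : cj N f c <= N.
Proof.
rewrite -[X in _ <= X](card_ord N) -sum1_card /cj big_mkcond.
by apply: leq_sum => k _; apply: leq_b1.
Qed.

Lemma eq_cj N f g c : (forall k, k < N -> f k = g k) -> cj N f c = cj N g c.
Proof. by move=> eqfg; apply: eq_bigr => k _; rewrite eqfg. Qed.

(** As [f] is weakly decreasing, the rows longer than [c] form an initial segment, and [cj N f c] is
    its length. *)
Lemma lt_cj N f c k : antitone f -> (k < cj N f c) = (k < N) && (c < f k).
Proof.
move=> anti_f; elim: N k => [|N IH] k; first by rewrite /cj big_ord0.
rewrite /cj big_ord_recr /= -/(cj N f c).
have [c_fN|fN_c] := ltnP c (f N).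
  have := IH (cj N f c); have := IH N; rewrite !ltnn.
  have [cjN|Ncj] := ltnP (cj N f c) N => /= [_|cjleN _].
    by have := antitone_le anti_f (ltnW cjN); case: ltnP => //; lia.
  have [kN|Nk] := ltnP k N.+1; last by lia.
  by have := antitone_le anti_f (_ : k <= N); lia.
rewrite addn0 IH ltnS; case: ltngtP => // ->; lia.
Qed.

Lemma sum_ltn d m : \sum_(c < d) (c < m) = minn d m.
Proof.
elim: d => [|d IH]; first by rewrite big_ord0 min0n.
by rewrite big_ord_recr /= IH; lia.
Qed.

(** Transposing twice restores the diagram; the hypotheses place it in an [N] by [d] box, so that
    neither truncated sum loses a cell. *)
Lemma cjK d N f k :
    antitone f -> (forall l, N <= l -> f l = 0) -> (forall l, f l <= d) ->
  cj d (cj N f) k = f k.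
Proof.
move=> anti_f f0 f_d; rewrite /cj -/(cj N f).
under eq_bigr => c _ do rewrite lt_cj //.
have [k_N|/f0->] := ltnP k N; last by rewrite big1 // => c _; rewrite andbC.
by rewrite (eq_bigr (fun c : 'I_d => (c < f k) : nat)) // sum_ltn; apply/minn_idPr.
Qed.

Lemma sum_cj d N f : (forall k, f k <= d) -> \sum_(c < d) cj N f c = \sum_(k < N) f k.
Proof.
move=> f_d; rewrite exchange_big /=; apply: eq_bigr => k _.
by rewrite sum_ltn; apply/minn_idPr.
Qed.

(** * Ballot words and the exchange of rows and columns *)

Lemma count_takeS (w : seq nat) p k : p < size w ->
  count_mem k (take p.+1 w) = count_mem k (take p w) + (nth 0 w p == k).
Proof. by move=> p_w; rewrite (take_nth 0) // -cats1 count_cat /= addn0. Qed.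

Definition ballot (w : seq nat) := forall p, antitone (fun k => count_mem k (take p w)).

(* Exchanges the word of rows and the word of columns of a standard tableau. *)
Definition conjw (w : seq nat) := mkseq (fun p => count_mem (nth 0 w p) (take p w)) (size w).

Lemma size_conjw w : size (conjw w) = size w. Proof. exact: size_mkseq. Qed.

Lemma nth_conjw w p : p < size w -> nth 0 (conjw w) p = count_mem (nth 0 w p) (take p w).
Proof. exact: nth_mkseq. Qed.

(** Reading a letter [k] of [w] adds a cell to row [k], and [conjw w] records the column of that
    cell. Hence the contents of corresponding prefixes are transposes of each other. *)
Lemma count_conjw N w p c : {in w, forall k, k < N} -> p <= size w ->
  count_mem c (take p (conjw w)) = cj N (fun k => count_mem k (take p w)) c.
Proof.
move=> w_N; elim: p => [|p IH] p_w.
  by rewrite !take0 /cj big1 // => k _; rewrite ltn0.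
rewrite count_takeS ?size_conjw // IH ?(ltnW p_w) // nth_conjw //.
have wp_N : nth 0 w p < N by rewrite w_N ?mem_nth.
rewrite [RHS](eq_bigr (fun k : 'I_N => (c < count_mem (val k) (take p w)) +
    ((nth 0 w p == k) && (count_mem (val k) (take p w) == c)))); last first.
  by move=> k _; rewrite count_takeS //=; case: eqP => /= _; lia.
rewrite big_split /=; congr (_ + _).
rewrite (bigD1 (Ordinal wp_N)) //= eqxx big1 ?addn0 // => k k_wp.
by case: eqP => //= wpk; case/eqP: k_wp; apply: val_inj; rewrite /= wpk.
Qed.

Lemma seq_bound (w : seq nat) : exists N, {in w, forall k, k < N}.
Proof.
exists (sumn w).+1 => k; rewrite ltnS; elim: w => //= x w IH.
by rewrite inE => /predU1P[->|/IH]; lia.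
Qed.

Lemma ballot_conjw w : ballot (conjw w).
Proof.
have [N w_N] := seq_bound w; move=> p k.
have [p_w|w_p] := leqP p (size w).
  by rewrite !(count_conjw _ w_N p_w); apply: cj_antitone.
rewrite take_oversize ?size_conjw ?(ltnW w_p) // -[conjw w]take_size size_conjw.
by rewrite !(count_conjw _ w_N (leqnn _)); apply: cj_antitone.
Qed.

(** The letter of the double exchange at [p] counts the rows now longer than row [wp]. The ballot
    condition at [p] excludes rows from [wp] on, and at [p.+1] it includes all rows above [wp], so
    the count is [wp]. *)
Lemma conjwK w : ballot w -> conjw (conjw w) = w.
Proof.
move=> bw; have [N w_N] := seq_bound w.
apply: (@eq_from_nth _ 0); rewrite !size_conjw // => p p_w.
rewrite !nth_conjw ?size_conjw // (count_conjw _ w_N (ltnW p_w)).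
have wp_N : nth 0 w p < N by rewrite w_N ?mem_nth.
set wp := nth 0 w p in wp_N *; set x := cj _ _ _.
have ltx k : k < x = (k < wp).
  rewrite /x (lt_cj _ _ _ (bw p)); have [wp_k|k_wp] := leqP wp k.
    by have := antitone_le (bw p) wp_k; lia.
  have := antitone_le (bw p.+1) (ltnW k_wp).
  rewrite !count_takeS // -/wp eqxx (gtn_eqF k_wp); lia.
by have := ltx x; have := ltx wp; lia.
Qed.

Lemma sorted_take (L : seq nat) q x y :
  sorted ltn L -> x \in take q L -> y \in L -> y < x -> y \in take q L.
Proof.
rewrite (sorted_pairwise ltn_trans) -{1 3}(cat_take_drop q L) pairwise_cat mem_cat.
case/and3P => /allrelP lt_td _ _ xt /orP[//|yd] y_x.
by have : x < y := lt_td x y xt yd; rewrite ltnNge ltnW.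
Qed.

(** The chamber condition tests only prefixes ending at block boundaries. Inside a block [c] is read
    before [c.+1], so the inequality at one of the two ends of the block settles every intermediate
    prefix. *)
Lemma ballot_wd d (s : seq {set 'I_d}) : ballot (wd s) <-> chamber s.
Proof.
split=> [bw | ].
  apply/chamberP => i c; have -> : wd (take i s) = take (size (wd (take i s))) (wd s).
    by rewrite -{3}(cat_take_drop i s) /wd map_cat flatten_cat take_size_cat.
  exact: bw.
elim/last_ind: s => [|s B IH]; first by move=> _ p c.
case/chamber_rcons => /IH bs wt p c; rewrite wd_rcons.
have [p_s|s_p] := leqP p (size (wd s)); first by rewrite takel_cat //; apply: bs.
rewrite take_cat ltnNge (ltnW s_p) /= !count_cat.
set q := p - _; rewrite ![count_mem _ (take _ _)]count_uniq_mem ?take_uniq ?uniq_blk //.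
move: (wt c) (bs (size (wd s)) c); rewrite !count_wd_rcons /= take_size.
have [c1|_] := boolP (c.+1 \in take q (blk B)); last first.
  by move=> _ /leq_trans le_c; rewrite addn0 /= le_c // leq_addr.
rewrite (mem_take c1); have [cB|_] := boolP (c \in blk B).
  by rewrite (sorted_take (sorted_blk B) c1 cB (ltnSn c)); lia.
by rewrite addn0 => /leq_trans le_c _; rewrite /= le_c // leq_addr.
Qed.

(** The entries below [x] form a prefix of an increasing list. This translates strictness along
    columns into comparisons of letter counts. *)
Lemma nth_lt_count (L : seq nat) j x : sorted ltn L -> j < size L ->
  (nth 0 L j < x) = (j < count (fun y => y < x) L).
Proof.
elim: L j => //= y L IH j; rewrite (path_sortedE ltn_trans) => /andP[/allP y_lt srt].
have cnt0 : x <= y -> count (fun z => z < x) L = 0.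
  move=> x_y; apply/eqP; rewrite -leqn0 leqNgt -has_count; apply/hasPn => z /y_lt /= y_z.
  by rewrite -leqNgt (leq_trans x_y) // ltnW.
case: j => [_|j j_L] /=; first by case: (ltnP y x) => // /cnt0->.
by rewrite (IH _ srt j_L); case: (ltnP y x) => [_|/cnt0->]; lia.
Qed.

Lemma count_iota_lt (a : pred nat) m x : x <= m ->
  count (fun p => (p < x) && a p) (iota 0 m) = count a (iota 0 x).
Proof.
move=> x_m; rewrite -{1}(subnKC x_m) iotaD count_cat add0n.
rewrite [X in _ + X](@eq_in_count _ _ pred0) ?count_pred0 ?addn0.
  by apply: eq_in_count => p; rewrite mem_iota => /andP[_ ->].
by move=> p; rewrite mem_iota => /andP[x_p _] /=; rewrite ltnNge x_p.
Qed.

Lemma count_take_iota (w : seq nat) k x : x <= size w ->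
  count_mem k (take x w) = count (fun p => nth 0 w p == k) (iota 0 x).
Proof. by move=> x_w; rewrite -(map_nth_iota0 0 x_w) count_map. Qed.

Lemma perm_flatten_fibers (T : eqType) (f : T -> nat) (L : seq T) h :
  perm_eq (flatten (mkseq (fun k => [seq x <- L | f x == k]) h)) [seq x <- L | f x < h].
Proof.
elim: h => [|h IH]; first by rewrite (eq_filter (a2 := pred0)) ?filter_pred0.
rewrite /mkseq -addn1 iotaD map_cat flatten_cat /= cats0 add0n.
rewrite perm_sym -(perm_filterC (fun x => f x < h)) perm_sym -!filter_predI.
apply: perm_cat; first by rewrite (eq_filter (a2 := fun x => f x < h)) // => x /=; lia.
by rewrite (eq_filter (a2 := fun x => f x == h)) // => x /=; lia.
Qed.

(** * From ballot words to standard tableaux *)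

Definition tabrow (w : seq nat) k := [seq p.+1 | p <- iota 0 (size w) & nth 0 w p == k].

Lemma mem_tabrow w k p : (p.+1 \in tabrow w k) = (p < size w) && (nth 0 w p == k).
Proof. by rewrite mem_map ?mem_filter ?mem_iota; [rewrite andbC | exact: succn_inj]. Qed.

Lemma mem_tabrow0 w k : 0 \in tabrow w k = false.
Proof. by apply/mapP => -[]. Qed.

Lemma sorted_tabrow w k : sorted ltn (tabrow w k).
Proof.
rewrite sorted_map; apply: (sorted_filter ltn_trans).
exact: iota_ltn_sorted.
Qed.

Lemma size_tabrow w k : size (tabrow w k) = count_mem k w.
Proof. by rewrite size_map size_filter -count_take_iota // take_size. Qed.

Lemma count_tabrow w k x : x <= size w ->
  count (fun y => y < x.+1) (tabrow w k) = count_mem k (take x w).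
Proof.
move=> x_w; rewrite count_map count_filter count_take_iota //.
by rewrite -(count_iota_lt _ x_w).
Qed.

(** Here [a] is a column word and [conjw a] the row word; the number of rows is the length of column
    0. *)
Definition tabw (a : seq nat) := mkseq (tabrow (conjw a)) (count_mem 0 a).

Lemma conjw_lt a p : ballot a -> p < size a -> nth 0 (conjw a) p < count_mem 0 a.
Proof.
move=> ba p_a; rewrite nth_conjw //.
have := count_takeS (nth 0 a p) p_a; rewrite eqxx addn1.
have: count_mem (nth 0 a p) (take p.+1 a) <= count_mem (nth 0 a p) a.
  by rewrite -[X in _ <= count _ X](cat_take_drop p.+1 a) count_cat leq_addr.
have := antitone_le (ba (size a)) (leq0n (nth 0 a p)); rewrite take_size; lia.
Qed.

Lemma rowof_tabw a p : ballot a -> p < size a -> rowof (tabw a) p.+1 = nth 0 (conjw a) p.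
Proof.
move=> ba p_a; have wp_lt := conjw_lt ba p_a.
rewrite /rowof /tabw /mkseq find_map.
rewrite (@eq_find _ _ (pred1 (nth 0 (conjw a) p))); last first.
  by move=> k /=; rewrite mem_tabrow size_conjw p_a eq_sym.
have := @index_uniq _ 0 _ (iota 0 (count_mem 0 a)) _ (iota_uniq _ _).
by move=> /(_ (nth 0 (conjw a) p)); rewrite size_iota nth_iota // add0n; apply.
Qed.

Lemma count_conjw_all d a k : {in a, forall c, c < d} ->
  count_mem k (conjw a) = cj d (fun c => count_mem c a) k.
Proof.
move=> a_d; rewrite -[conjw a]take_size size_conjw (count_conjw _ a_d) //.
by rewrite take_size.
Qed.

Lemma shape_tabw d a : {in a, forall c, c < d} ->
  map size (tabw a) = mkseq (cj d (fun c => count_mem c a)) (count_mem 0 a).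
Proof.
move=> a_d; rewrite /tabw /mkseq -map_comp; apply: eq_map => k /=.
by rewrite size_tabrow (count_conjw_all _ a_d).
Qed.

Lemma tabw_syt d a : ballot a -> {in a, forall c, c < d} -> is_syt (size a) d (tabw a).
Proof.
move=> ba a_d; have sh := shape_tabw a_d.
have anti_a : antitone (fun c => count_mem c a) by have := ba (size a); rewrite take_size.
have d_gt0 k : k < count_mem 0 a -> 0 < d.
  by case: (a) a_d => // c a' /(_ c); rewrite mem_head => /(_ isT); lia.
apply/andP; split; [|apply/and5P; split].
- rewrite -(all_map size (fun m => 0 < m)) sh all_map; apply/allP => k /=.
  rewrite mem_iota add0n => /= k_lt; rewrite (lt_cj _ _ _ (anti_a)) (d_gt0 k) //.
- rewrite sh /mkseq sorted_map; apply/(sortedP 0) => i.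
  rewrite size_iota => i_lt; rewrite /= !nth_iota ?(ltnW i_lt) //.
  exact: cj_antitone.
- by apply/allP => L /mapP[k _ ->]; apply: sorted_tabrow.
- apply/allP => k; rewrite mem_iota add0n size_mkseq => /andP[_ k_lt].
  have k1_lt : k.+1 < count_mem 0 a by rewrite -ltn_predRL.
  rewrite !nth_mkseq ?(ltnW k1_lt) //; apply/allP => j.
  rewrite mem_iota add0n => /= j_lt.
  have bw := @ballot_conjw a.
  have : nth 0 (tabrow (conjw a) k.+1) j \in tabrow (conjw a) k.+1 by rewrite mem_nth.
  case E: (nth 0 _ j) => [|p]; first by rewrite mem_tabrow0.
  rewrite mem_tabrow => /andP[p_lt /eqP wp].
  have j_lt' : j < size (tabrow (conjw a) k).
    rewrite size_tabrow (leq_trans j_lt) // size_tabrow.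
    by have := bw (size a) k; rewrite -size_conjw take_size.
  (* Among [1, ..., p.+1] more than [j] numbers lie in row [k.+1], hence also in row [k]. As [p.+1]
     is not in row [k], more than [j] numbers of row [k] are at most [p]. *)
  have : nth 0 (tabrow (conjw a) k.+1) j < p.+2 by rewrite E.
  rewrite nth_lt_count ?sorted_tabrow // count_tabrow //.
  have := bw p.+1 k; rewrite (count_takeS k p_lt) wp gtn_eqF // addn0 => le1 le2.
  by rewrite nth_lt_count ?sorted_tabrow // count_tabrow ?(ltnW p_lt) // (leq_trans le2).
- have -> : flatten (tabw a) = map succn (flatten (mkseq (fun k =>
      [seq p <- iota 0 (size a) | nth 0 (conjw a) p == k]) (count_mem 0 a))).
    rewrite map_flatten /tabw /mkseq -map_comp; congr flatten; apply: eq_map => k /=.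
    by rewrite /tabrow size_conjw.
  rewrite -[1]addn0 iotaDl; apply: perm_map.
  apply: (perm_trans (perm_flatten_fibers _ _ _)).
  rewrite (@eq_in_filter _ _ predT) ?filter_predT // => p.
  by rewrite mem_iota => /= p_a; rewrite conjw_lt.
- rewrite -(all_map size (fun m => m <= d)) sh all_map; apply/allP => k _ /=.
  exact: cj_le.
Qed.

(** The row of a letter is the number of earlier equal letters; by the ballot condition a larger
    letter has occurred at most as often, so an ascent moves weakly up. *)
Lemma condThat_tabw r n a : size a = r * n -> ballot a -> incr r a -> condThat r n (tabw a).
Proof.
move=> sz_a ba inc_a; apply/allP => k; rewrite mem_iota => /andP[k_gt0 k_lt].
apply/implyP => kr; case: k k_gt0 k_lt kr => // p _ p_lt pr.
have p1_a : p.+1 < size a by lia.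
rewrite !rowof_tabw ?(ltnW p1_a) // !nth_conjw ?(ltnW p1_a) //.
have inc_p := inc_a p p1_a pr.
rewrite (count_takeS _ (ltnW p1_a)) (ltn_eqF inc_p) addn0.
exact: (antitone_le (ba p) (ltnW inc_p)).
Qed.

Lemma tabw_inj a a' : ballot a -> ballot a' -> size a = size a' -> tabw a = tabw a' -> a = a'.
Proof.
move=> ba ba' sz_a eqt; rewrite -[a]conjwK // -[a']conjwK //; congr conjw.
apply: (@eq_from_nth _ 0); rewrite !size_conjw // => p p_a.
by rewrite -!rowof_tabw ?eqt // -sz_a.
Qed.

Lemma rowof_uniq t k y :
  uniq (flatten t) -> k < size t -> y \in nth [::] t k -> rowof t y = k.
Proof.
rewrite /rowof; elim: t k => //= L t IH [|k]; first by move=> _ _ ->.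
rewrite cat_uniq ltnS => /and3P[_ /hasPn disj u_t] k_t yk.
rewrite (negbTE (disj y _)) ?(IH k) //.
by apply/flattenP; exists (nth [::] t k) => //; apply: mem_nth.
Qed.

Lemma count_take_le (w : seq nat) k p : count_mem k (take p w) <= count_mem k w.
Proof. by rewrite -[X in _ <= count _ X](cat_take_drop p w) count_cat leq_addr. Qed.

(** After [p.+1] letters row [nth 0 w p] has just received a cell, and a row weakly above it is at
    least as long, so the next cell lies in a later column. *)
Lemma conjw_incr r w : ballot w ->
    (forall p, p.+1 < size w -> p.+1 %% r != 0 -> nth 0 w p.+1 <= nth 0 w p) ->
  incr r (conjw w).
Proof.
move=> bw dec_w p; rewrite size_conjw => p1_w pr.
rewrite !nth_conjw ?(ltnW p1_w) //; have le_w := dec_w p p1_w pr.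
have := antitone_le (bw p.+1) le_w.
by rewrite [X in X <= _](count_takeS _ (ltnW p1_w)) eqxx addn1.
Qed.

(** * From standard tableaux back to ballot words *)

Section Surjectivity.

Variables (m d : nat) (t : seq (seq nat)).
Hypothesis syt_t : is_syt m d t.

Let row k := nth [::] t k.

Lemma syt_row_gt0 k : k < size t -> 0 < size (row k).
Proof. by case/and5P: syt_t => /allP row_gt0 _ _ _ _ k_t; apply/row_gt0/mem_nth. Qed.

Lemma syt_row_le k : size (row k) <= d.
Proof.
case/andP: syt_t => _ /and5P[_ _ _ _ /allP row_d].
have [k_t|t_k] := ltnP k (size t); first by apply/row_d/mem_nth.
by rewrite /row nth_default.
Qed.

Lemma syt_shape_antitone : antitone (fun k => size (row k)).
Proof.
move=> k; case/and3P: syt_t => _ /(sortedP 0) srt _.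
have [k_t|t_k] := ltnP k.+1 (size t); last by rewrite /row nth_default.
by move: (srt k); rewrite size_map !(nth_map [::]) ?(ltnW k_t) //; apply.
Qed.

Lemma syt_row_sorted k : sorted ltn (row k).
Proof.
case/and4P: syt_t => _ _ /allP srt _.
have [k_t|t_k] := ltnP k (size t); first by apply/srt/mem_nth.
by rewrite /row nth_default.
Qed.

Lemma syt_col k j : j < size (row k.+1) -> nth 0 (row k) j < nth 0 (row k.+1) j.
Proof.
move=> j_lt; case/and5P: syt_t => _ _ _ /allP col _.
have k_t : k.+1 < size t by case: (ltnP k.+1 (size t)) j_lt => // t_k; rewrite /row nth_default.
have: k \in iota 0 (size t).-1 by rewrite mem_iota add0n ltn_predRL.
by move/col/allP; apply; rewrite mem_iota.
Qed.

Lemma syt_mem y : (y \in flatten t) = (0 < y <= m).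
Proof.
case/andP: syt_t => _ /and5P[_ _ _ /perm_mem-> _]; by rewrite mem_iota add1n ltnS.
Qed.

Lemma syt_uniq : uniq (flatten t).
Proof. by case/andP: syt_t => _ /and5P[_ _ _ /perm_uniq-> _]; apply: iota_uniq. Qed.

Definition row_word := mkseq (fun p => rowof t p.+1) m.

Lemma rowof_lt p : p < m -> rowof t p.+1 < size t.
Proof.
by move=> p_m; rewrite -has_find; apply/hasP/flattenP; rewrite syt_mem.
Qed.

Lemma tabrow_row_word k : tabrow row_word k = row k.
Proof.
apply: (irr_sorted_eq ltn_trans ltnn); rewrite ?sorted_tabrow ?syt_row_sorted //.
have row_mem y : y \in row k -> 0 < y <= m /\ k < size t.
  move=> yk; have k_t : k < size t by case: (ltnP k (size t)) yk => // t_k; rewrite /row nth_default.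
  by rewrite -syt_mem; split=> //; apply/flattenP; exists (row k); rewrite // mem_nth.
case=> [|p]; first by rewrite mem_tabrow0; apply/esym/negP => /row_mem[].
rewrite mem_tabrow size_mkseq; apply/andP/idP => [[p_m]|yk].
  rewrite nth_mkseq // => /eqP <-; apply: (@nth_find _ [::] (fun L => p.+1 \in L) t).
  by rewrite has_find; apply: rowof_lt.
have [/andP[_ p_m] k_t] := row_mem _ yk.
by split=> //; rewrite nth_mkseq // (rowof_uniq syt_uniq k_t yk).
Qed.

Lemma count_row_word k : count_mem k row_word = size (row k).
Proof. by rewrite -size_tabrow tabrow_row_word. Qed.

(** Let [x] entries of row [k] be at most [p]. If row [k.+1] had more such entries, its entry in
    column [x] would be at most [p] while the one above exceeds [p], against strictness along
    columns. *)
Lemma ballot_row_word : ballot row_word.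
Proof.
suff bw p : p <= m -> antitone (fun k => count_mem k (take p row_word)).
  move=> p; have [/bw//|m_p] := leqP p m.
  rewrite take_oversize ?size_mkseq ?(ltnW m_p) //.
  by have := bw m (leqnn m); rewrite take_oversize ?size_mkseq.
move=> p_m k; rewrite -!count_tabrow ?size_mkseq // !tabrow_row_word leqNgt.
apply/negP; set x := count _ (row k) => x_lt.
have x_row : x < size (row k.+1) by apply: leq_trans x_lt (count_size _ _).
have x_row' : x < size (row k) by apply: leq_trans x_row (syt_shape_antitone k).
have := syt_col x_row; rewrite ltnNge => /negP[].
move: x_lt; rewrite -(nth_lt_count _ (syt_row_sorted _) x_row) => lt_p.
have := nth_lt_count p.+1 (syt_row_sorted _) x_row'; rewrite -/x ltnn; lia.
Qed.

Lemma conjw_row_word_lt : {in conjw row_word, forall c, c < d}.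
Proof.
move=> c /(nthP 0)[p]; rewrite size_conjw => p_lt <-; rewrite nth_conjw //.
apply: leq_trans (syt_row_le (nth 0 row_word p)); rewrite -count_row_word.
by apply: leq_trans (count_take_le _ _ p.+1); rewrite count_takeS // eqxx addn1.
Qed.

Lemma tabw_row_word : tabw (conjw row_word) = t.
Proof.
have size_t : count_mem 0 (conjw row_word) = size t.
  rewrite (@count_conjw_all (size t)).
    rewrite /cj (eq_bigr (fun=> 1)) ?sum1_card ?card_ord // => k _.
    by rewrite count_row_word syt_row_gt0.
  by move=> c /mapP[p]; rewrite mem_iota => p_m ->; apply: rowof_lt.
apply: (@eq_from_nth _ [::]); rewrite size_mkseq // size_t => k k_t.
by rewrite nth_mkseq ?size_t // conjwK ?tabrow_row_word //; apply: ballot_row_word.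
Qed.

End Surjectivity.

Lemma tabw_surj r n d t : is_syt (r * n) d t -> condThat r n t ->
  exists a, [/\ size a = r * n, ballot a, incr r a, {in a, forall c, c < d} & tabw a = t].
Proof.
move=> syt_t /allP cond_t; exists (conjw (row_word (r * n) t)); split.
- by rewrite size_conjw size_mkseq.
- exact: ballot_conjw.
- apply: conjw_incr => [|p]; first exact: (ballot_row_word syt_t).
  rewrite size_mkseq => p1_lt pr; rewrite !nth_mkseq ?(ltnW p1_lt) //.
  have /cond_t/implyP/(_ pr)// : p.+1 \in iota 1 (r * n).-1.
  by rewrite mem_iota; lia.
- exact: (conjw_row_word_lt syt_t).
exact: (tabw_row_word syt_t).
Qed.

(** Shape and content are row and column lengths of one diagram, so [cjK] recovers the content. The
    box side [f a 0] is the common number of rows, hence only rows listed in the shape enter. *)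
Lemma tabw_same_shape d a a' : ballot a -> ballot a' ->
    {in a, forall c, c < d} -> {in a', forall c, c < d} ->
  map size (tabw a) = map size (tabw a') <-> forall c, count_mem c a = count_mem c a'.
Proof.
move=> ba ba' a_d a_d'; rewrite !(@shape_tabw d) //; split=> [eqsh c | eqc].
  have sz0 : count_mem 0 a = count_mem 0 a' by have := congr1 size eqsh; rewrite !size_mkseq.
  pose f (b : seq nat) c := count_mem c b.
  have anti b : ballot b -> antitone (f b) by move=> /(_ (size b)); rewrite take_size.
  have f0 b : {in b, forall c, c < d} -> forall l, d <= l -> f b l = 0.
    by move=> b_d l d_l; apply/count_memPn/negP => /b_d; lia.
  have le0 b : ballot b -> forall l, f b l <= f b 0.
    by move=> bb l; apply: (antitone_le (anti _ bb)).
  rewrite -/(f a c) -/(f a' c) -(cjK (d := f a 0) c (anti _ ba) (f0 _ a_d) (le0 _ ba)).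
  rewrite -(cjK (d := f a 0) c (anti _ ba') (f0 _ a_d')); last by rewrite [f a 0]sz0; apply: le0.
  apply: eq_cj => k k_lt; have := congr1 (nth 0 ^~ k) eqsh.
  by rewrite /= !nth_mkseq -?sz0.
rewrite eqc; apply/eq_map => k; apply: eq_cj => c _; exact: eqc.
Qed.

(** * Tableau pairs counted by pairs of chamber families *)

Section TableauPairs.

Variables r n d : nat.

Definition good_pairs : seq (seq {set 'I_d} * seq {set 'I_d}) :=
  [seq ss <- fampairs d r n | [&& chamber ss.1, chamber ss.2 & same_content ss]].

Lemma mem_good_pairs s1 s2 : (s1, s2) \in good_pairs =
  [&& fam r n s1, fam r n s2, chamber s1, chamber s2 & same_content (s1, s2)].
Proof.
rewrite mem_filter /= andbC; have [F|] := boolP (_ \in fampairs _ _ _); last first.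
  move=> /negP nF; apply/esym/negP => /and5P[F1 F2 _ _ _]; case: nF.
  by apply/allpairsP; exists (s1, s2); rewrite !mem_fams.
by case/allpairsP: F => -[s1' s2'] /=; rewrite !mem_fams => -[F1 F2 [-> ->]]; rewrite F1 F2.
Qed.

Lemma uniq_good_pairs : uniq good_pairs.
Proof.
by rewrite filter_uniq // allpairs_uniq ?uniq_fams // => -[? ?] [? ?] _ _ [-> ->].
Qed.

Lemma same_contentP (s1 s2 : seq {set 'I_d}) :
  reflect (forall c, count_mem c (wd s1) = count_mem c (wd s2)) (same_content (s1, s2)).
Proof.
apply: (iffP forallP) => [eqc c | eqc c]; last by rewrite eqc.
have [c_d|d_c] := ltnP c d; first exact: (eqP (eqc (Ordinal c_d))).
by rewrite !(count_memPn _) //; apply/negP => /wd_lt; lia.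
Qed.

Definition tab_pair (ss : seq {set 'I_d} * seq {set 'I_d}) := (tabw (wd ss.1), tabw (wd ss.2)).

Lemma wd_ltd (s : seq {set 'I_d}) : {in wd s, forall c, c < d}.
Proof. by move=> c; apply: wd_lt. Qed.

Lemma tab_pair_ok : exists s : seq (seq (seq nat) * seq (seq nat)),
  [/\ uniq s, forall PQ, PQ \in s = tabpair_ok r n d PQ & size s = size good_pairs].
Proof.
exists (map tab_pair good_pairs); split; last by rewrite size_map.
  rewrite map_inj_in_uniq ?uniq_good_pairs // => -[s1 s2] [s1' s2'].
  rewrite !mem_good_pairs => /and5P[F1 F2 ch1 ch2 _] /and5P[F1' F2' ch1' ch2' _] [].
  move=> /tabw_inj eq1 /tabw_inj eq2; congr (_, _).
    by apply: (wd_inj F1 F1'); apply: eq1; rewrite ?(size_wd F1) ?(size_wd F1') //;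
      apply/ballot_wd.
  by apply: (wd_inj F2 F2'); apply: eq2; rewrite ?(size_wd F2) ?(size_wd F2') //;
    apply/ballot_wd.
have tab_ok (s : seq {set 'I_d}) : fam r n s -> chamber s ->
    is_syt (r * n) d (tabw (wd s)) /\ condThat r n (tabw (wd s)).
  move=> F /ballot_wd bs; have sz := size_wd F; rewrite mulnC in sz; split.
    by rewrite -sz; apply: tabw_syt => //; apply: wd_ltd.
  by apply: condThat_tabw => //; apply: wd_incr F.
have fam_surj t : is_syt (r * n) d t -> condThat r n t ->
    exists s : seq {set 'I_d}, [/\ fam r n s, chamber s & tabw (wd s) = t].
  move=> syt_t cond_t; have [a [sz_a ba inc_a a_d ta]] := tabw_surj syt_t cond_t.
  have [|s F sa] := incr_wd (n := n) _ inc_a a_d; first by rewrite mulnC.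
  by exists s; rewrite sa; split=> //; apply/ballot_wd; rewrite sa.
move=> [P Q]; apply/mapP/and5P => [[[s1 s2]] | /= [sytP sytQ /eqP sh cP cQ]].
  rewrite mem_good_pairs => /and5P[F1 F2 ch1 ch2 /same_contentP eqc] [-> ->] /=.
  have [? ?] := tab_ok _ F1 ch1; have [? ?] := tab_ok _ F2 ch2; split=> //.
  exact/eqP/(tabw_same_shape ((ballot_wd _).2 ch1) ((ballot_wd _).2 ch2) (@wd_ltd s1) (@wd_ltd s2)).
have [s1 [F1 ch1 t1]] := fam_surj P sytP cP; have [s2 [F2 ch2 t2]] := fam_surj Q sytQ cQ.
exists (s1, s2); last by rewrite /tab_pair t1 t2.
rewrite mem_good_pairs F1 F2 ch1 ch2; apply/same_contentP.
by apply/(tabw_same_shape ((ballot_wd _).2 ch1) ((ballot_wd _).2 ch2) (@wd_ltd s1) (@wd_ltd s2)); rewrite t1 t2.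
Qed.

End TableauPairs.

(** * Horizontal strips, written as interlacing row lengths, and growth diagrams *)

Definition hstrip (la nu : nat -> nat) := forall k, nu k.+1 <= la k <= nu k.

Lemma eq_hstrip la la' nu nu' : la =1 la' -> nu =1 nu' -> hstrip la nu -> hstrip la' nu'.
Proof. by move=> eql eqn st k; rewrite -eql -!eqn. Qed.

(* Fomin's local rule for RSK, written in terms of row lengths: [kappa] is the
   partition at the corner nearest to the origin, and [x] the matrix entry of the cell. *)
Definition local_rule (kappa la nu : nat -> nat) x k :=
  if k is k'.+1 then maxn (la k) (nu k) + minn (la k') (nu k') - kappa k'
  else maxn (la 0) (nu 0) + x.

(** This solves the local rule for [rho k.+1] with respect to [kappa k]. *)
Definition local_back (la nu rho : nat -> nat) k :=
  maxn (la k.+1) (nu k.+1) + minn (la k) (nu k) - rho k.+1.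

Lemma eq_local_rule kappa kappa' la la' nu nu' x :
    kappa =1 kappa' -> la =1 la' -> nu =1 nu' ->
  local_rule kappa la nu x =1 local_rule kappa' la' nu' x.
Proof. by move=> eqk eql eqn [|k] /=; rewrite ?eqk !eql !eqn. Qed.

Lemma local_ruleC kappa la nu x : local_rule kappa la nu x =1 local_rule kappa nu la x.
Proof. by case=> [|k] /=; rewrite maxnC // minnC. Qed.

Lemma eq_local_back la la' nu nu' rho rho' :
  la =1 la' -> nu =1 nu' -> rho =1 rho' -> local_back la nu rho =1 local_back la' nu' rho'.
Proof. by move=> eql eqn eqr k; rewrite /local_back !eql !eqn eqr. Qed.

(** Interlacing puts [kappa k] between the maximum in row [k.+1] and the minimum in row [k]. Hence
    the subtraction is exact and the new row [k.+1] lies between the same two bounds. *)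
Lemma local_rule_hstrip kappa la nu x : hstrip kappa la -> hstrip kappa nu ->
  hstrip la (local_rule kappa la nu x).
Proof.
move=> stl stn [|k] /=; first by have := stl 0; have := stn 0; lia.
by have := stl k; have := stn k; have := stl k.+1; have := stn k.+1; lia.
Qed.

Lemma local_back_hstrip la nu rho : hstrip la rho -> hstrip nu rho ->
  hstrip (local_back la nu rho) la.
Proof.
by move=> stl stn k; rewrite /local_back; have := stl k; have := stn k;
  have := stl k.+1; have := stn k.+1; lia.
Qed.

Lemma local_backC la nu rho : local_back la nu rho =1 local_back nu la rho.
Proof. by move=> k; rewrite /local_back maxnC minnC. Qed.

Lemma local_backK la nu rho : hstrip la rho -> hstrip nu rho ->
  local_rule (local_back la nu rho) la nu (rho 0 - maxn (la 0) (nu 0)) =1 rho.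
Proof.
move=> stl stn [|k] /=; first by have := stl 0; have := stn 0; lia.
by rewrite /local_back; have := stl k; have := stn k; have := stl k.+1; have := stn k.+1; lia.
Qed.

Lemma local_ruleK kappa la nu x : hstrip kappa la -> hstrip kappa nu ->
  local_back la nu (local_rule kappa la nu x) =1 kappa.
Proof. by move=> stl stn k; rewrite /local_back /=; have := stl k; have := stn k; lia. Qed.

(** Maximum and minimum add up to [la k + nu k], so the sizes satisfy |rho| + |kappa| = |la| + |nu|
    + x; the extra minimum is what truncation after row [N] leaves over. *)
Lemma sum_local_rule N kappa la nu x : hstrip kappa la -> hstrip kappa nu ->
  \sum_(k < N.+1) local_rule kappa la nu x k + \sum_(k < N) kappa k + minn (la N) (nu N)
  = \sum_(k < N.+1) la k + \sum_(k < N.+1) nu k + x.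
Proof.
move=> stl stn; elim: N => [|N IH]; first by rewrite !big_ord1 big_ord0 /=; lia.
rewrite big_ord_recr [\sum_(k < N.+1) kappa k]big_ord_recr /=.
rewrite [\sum_(k < N.+2) la k]big_ord_recr [\sum_(k < N.+2) nu k]big_ord_recr /=.
move: IH (stl N) (stn N).
set A := \sum_(i < N.+1) local_rule _ _ _ _ _; set B := \sum_(i < N) _.
set C := \sum_(i < N.+1) la _; set D := \sum_(i < N.+1) nu _; lia.
Qed.

(** The inner recursion on [j] gives access to the neighbour in the same row, the outer one to the
    two neighbours in the previous row. *)
Fixpoint growth (m : nat -> nat -> nat) i : nat -> nat -> nat :=
  if i is i'.+1 then
    fix grow j := if j is j'.+1 then
        local_rule (growth m i' j') (grow j') (growth m i' j) (m i' j')
      else fun=> 0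
  else fun _ _ => 0.

Arguments growth : simpl never.

Lemma growthSS m i j : growth m i.+1 j.+1 =
  local_rule (growth m i j) (growth m i.+1 j) (growth m i j.+1) (m i j).
Proof. by []. Qed.

Lemma growth0 m i : growth m i 0 = fun=> 0. Proof. by case: i. Qed.

Lemma growthT m i j : growth m i j =1 growth (fun a b => m b a) j i.
Proof.
elim: i j => [|i IHi] j; first by rewrite growth0.
elim: j => // j IHj; rewrite !growthSS => k; rewrite local_ruleC.
exact: eq_local_rule.
Qed.

Lemma growth_hstrip_row m i j : hstrip (growth m i j) (growth m i j.+1).
Proof.
(* Both directions go through one induction, since the local rule preserves strips only if both
   strips leave the corner [kappa]. *)
suff: (forall j, hstrip (growth m i j) (growth m i.+1 j)) /\
      (forall j, hstrip (growth m i j) (growth m i j.+1)) by case.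
elim: i {j} => [|i [IHv IHh]].
  split=> // j; elim: j => // j IHj; rewrite growthSS.
  by apply: eq_hstrip (local_rule_hstrip _ _ IHj) => //; apply: local_ruleC.
have Hh j : hstrip (growth m i.+1 j) (growth m i.+1 j.+1).
  by rewrite growthSS; apply: local_rule_hstrip.
split=> // j; elim: j => [|j IHj]; first by rewrite !growth0.
by rewrite growthSS; apply: eq_hstrip (local_rule_hstrip _ (Hh j) IHj) => // k; rewrite local_ruleC.
Qed.

Lemma growth_hstrip_col m i j : hstrip (growth m i j) (growth m i.+1 j).
Proof.
by apply: eq_hstrip (growth_hstrip_row (fun a b => m b a) j i) => k; rewrite growthT.
Qed.

Lemma growth_support m i j k : i <= k -> growth m i j k = 0.
Proof.
elim: i j k => // i IHi; elim=> // j IHj [|k] //= i_k.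
have := growth_hstrip_col m i j k; have := growth_hstrip_row m i j k.
have := growth_hstrip_row m i.+1 j k; rewrite growthSS /=.
have := IHj k.+1; have := IHi j.+1 k; have := IHi j.+1 k.+1; lia.
Qed.

Lemma sum_growth m N i j : i < N ->
  \sum_(k < N) growth m i.+1 j k = \sum_(k < N) growth m i j k + \sum_(b < j) m i b.
Proof.
case: N => // N i_N; elim: j => [|j IHj]; first by rewrite !growth0 big_ord0 addn0.
have := sum_local_rule N (m i j) (growth_hstrip_col m i j) (growth_hstrip_row m i j).
(* With at most [i] rows and [i <= N], the boundary term of [sum_local_rule] vanishes. *)
have support k : growth m i k N = 0 by apply: growth_support.
rewrite support minn0 addn0 -growthSS IHj [\sum_(b < j.+1) _]big_ord_recr.
rewrite [\sum_(k < N.+1) growth m i j k]big_ord_recr /= support addn0.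
lia.
Qed.

(** From the two far sides, [local_back] determines all inner partitions, by induction on the
    distances [i'] and [j'] to the far corner; the first rows then give the entries. *)
Lemma growth_inj m m' n :
    (forall i, i <= n -> growth m i n =1 growth m' i n) ->
    (forall j, j <= n -> growth m n j =1 growth m' n j) ->
  forall i j, i < n -> j < n -> m i j = m' i j.
Proof.
move=> eqr eqc.
have eqg i' j' : i' <= n -> j' <= n ->
    growth m (n - i') (n - j') =1 growth m' (n - i') (n - j').
  elim: i' j' => [|i' IHi] j'; first by rewrite subn0 => _ _; apply/eqc/leq_subr.
  elim: j' => [|j' IHj] i_n j_n; first by rewrite subn0; apply/eqr/leq_subr.
  set i := n - i'.+1; set j := n - j'.+1.
  have iE : n - i' = i.+1 by lia.
  have jE : n - j' = j.+1 by lia.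
  move: (IHi j'.+1 (ltnW i_n) j_n) (IHj i_n (ltnW j_n)) (IHi j' (ltnW i_n) (ltnW j_n)).
  rewrite iE jE -/i -/j => eql eqn eqrho k.
  rewrite -(local_ruleK (m i j) (growth_hstrip_col m i j) (growth_hstrip_row m i j)).
  rewrite -(local_ruleK (m' i j) (growth_hstrip_col m' i j) (growth_hstrip_row m' i j)).
  exact: eq_local_back.
have eqg' i j : i <= n -> j <= n -> growth m i j =1 growth m' i j.
  move=> i_n j_n; have := @eqg (n - i) (n - j); rewrite !subKn //.
  by apply; apply: leq_subr.
move=> i j i_n j_n; have := eqg' i.+1 j.+1 i_n j_n 0.
rewrite !growthSS /= (eqg' i.+1 j i_n (ltnW j_n) 0) (eqg' i j.+1 (ltnW i_n) j_n 0).
exact: addnI.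
Qed.

(** * Reconstructing a matrix from two boundary chains *)

Section Backward.

Variables (n : nat) (la mu : nat -> nat -> nat).
Hypotheses (la0 : la 0 =1 fun=> 0) (mu0 : mu 0 =1 fun=> 0) (lamu : la n =1 mu n).
Hypothesis la_hstrip : forall i, i < n -> hstrip (la i) (la i.+1).
Hypothesis mu_hstrip : forall j, j < n -> hstrip (mu j) (mu j.+1).

(* Indices count backwards: [back i j] sits at position (n - i, n - j). *)
Fixpoint back i : nat -> nat -> nat :=
  if i is i'.+1 then
    fix bk j := if j is j'.+1 then local_back (back i' j) (bk j') (back i' j')
      else la (n - i)
  else fun j => mu (n - j).

Lemma backSS i j : back i.+1 j.+1 = local_back (back i j.+1) (back i.+1 j) (back i j).
Proof. by []. Qed.

Lemma back0 i : back i 0 =1 la (n - i).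
Proof. by case: i => // k; rewrite /= subn0 lamu. Qed.

Lemma back_hstrip i j : i <= n -> j <= n ->
  (i < n -> hstrip (back i.+1 j) (back i j)) /\ (j < n -> hstrip (back i j.+1) (back i j)).
Proof.
elim: i j => [|i IHi] j i_n j_n.
  have hz j' : j' < n -> hstrip (back 0 j'.+1) (back 0 j').
    by move=> j'_n /=; rewrite -(subnSK j'_n); apply: mu_hstrip; lia.
  split; last exact: hz.
  move=> n_gt0; elim: j j_n => [|j IHj] j_n.
    apply: (eq_hstrip (la := la (n - 1)) (nu := la (n - 0))) => [k|k|].
    - by rewrite back0.
    - by rewrite back0.
    by rewrite -(subnSK n_gt0); apply: la_hstrip; lia.
  rewrite backSS; apply: local_back_hstrip; first exact: hz.
  by apply: IHj; apply: ltnW.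
have hz j' : j' < n -> hstrip (back i.+1 j'.+1) (back i.+1 j').
  move=> j'_n; rewrite backSS; have [v h] := IHi j' (ltnW i_n) (ltnW j'_n).
  by apply: eq_hstrip (local_back_hstrip (v i_n) (h j'_n)) => // k; apply: local_backC.
split; last exact: hz.
move=> i1_n; elim: j j_n => [|j IHj] j_n.
  apply: (eq_hstrip (la := la (n - i.+2)) (nu := la (n - i.+1))) => [k|k|].
  - by rewrite back0.
  - by rewrite back0.
  by rewrite -(subnSK i1_n); apply: la_hstrip; lia.
rewrite backSS; apply: local_back_hstrip; first exact: hz.
by apply: IHj; apply: ltnW.
Qed.

Lemma hstrip_eq0 (f g : nat -> nat) : hstrip f g -> g =1 (fun=> 0) -> f =1 (fun=> 0).
Proof. by move=> st g0 k; have := st k; rewrite !g0; lia. Qed.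

(** The first-row case of the local rule solved for the matrix entry, indexed forwards. *)
Definition back_entry i j := back (n - i.+1) (n - j.+1) 0
  - maxn (back (n - i.+1) (n - j) 0) (back (n - i) (n - j.+1) 0).

Lemma growth_back_entry i j : i <= n -> j <= n ->
  growth back_entry i j =1 back (n - i) (n - j).
Proof.
elim: i j => [|i IHi] j i_n.
  rewrite subn0 => j_n k /=; apply/esym.
  (* The near sides must be empty for [growth] to start there: the common corner is [la 0 = 0], and
     interlacing below an empty partition forces emptiness along the side. *)
  suff z j' : j' <= n -> back n j' =1 (fun=> 0) by apply: z; apply: leq_subr.
  elim: j' => [|j' IHj] j'_n; first by move=> k'; rewrite back0 subnn la0.
  apply: hstrip_eq0 (IHj (ltnW j'_n)).
  by have [_] := back_hstrip (leqnn n) (ltnW j'_n); apply.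
elim: j => [|j IHj] j_n.
  rewrite subn0 growth0 => k /=; apply/esym.
  suff z i' : i' <= n -> back i' n =1 (fun=> 0) by apply: z; apply: leq_subr.
  elim: i' => [|i' IHi'] i'_n; first by move=> k'; rewrite /= subnn mu0.
  apply: hstrip_eq0 (IHi' (ltnW i'_n)).
  by have [+ _] := back_hstrip (ltnW i'_n) (leqnn n); apply.
rewrite growthSS => k; set p := n - i.+1; set q := n - j.+1.
have pE : n - i = p.+1 by lia.
have qE : n - j = q.+1 by lia.
move: (IHi j (ltnW i_n) (ltnW j_n)) (IHj (ltnW j_n)) (IHi j.+1 (ltnW i_n) j_n).
rewrite pE qE -/p -/q => eqk eql eqn.
rewrite (eq_local_rule _ eqk eql eqn) /back_entry pE qE -/p -/q.
have [v h] : hstrip (back p.+1 q) (back p q) /\ hstrip (back p q.+1) (back p q).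
  have [||v h] := @back_hstrip p q; try exact: leq_subr.
  by split; [apply: v | apply: h]; rewrite /p /q; lia.
by rewrite backSS local_backK.
Qed.

End Backward.

(** * Largest planar subgraphs and last passage *)

Definition total (S : nat -> nat -> nat) i j := \sum_(a < i) \sum_(b < j) S a b.

Lemma totalSr S i j : total S i j.+1 = total S i j + \sum_(a < i) S a j.
Proof.
rewrite /total -big_split /=; apply: eq_bigr => a _.
by rewrite big_ord_recr.
Qed.

Lemma totalSl S i j : total S i.+1 j = total S i j + \sum_(b < j) S i b.
Proof. by rewrite /total big_ord_recr. Qed.

Definition noncrossing (S : nat -> nat -> nat) := forall a b a' b',
  0 < S a b -> 0 < S a' b' -> (a <= a') && (b <= b') || (a' <= a) && (b' <= b).

Lemma growth_first m i j : growth m i.+1 j.+1 0 =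
  maxn (growth m i.+1 j 0) (growth m i j.+1 0) + m i j.
Proof. by rewrite growthSS. Qed.

Lemma total_le_growth m S i j : (forall a b, S a b <= m a b) -> noncrossing S ->
  total S i j <= growth m i j 0.
Proof.
move=> S_m ncS; elim: i j => [|i IHi] j; first by rewrite /total big_ord0.
elim: j => [|j IHj]; first by rewrite /total big1 // => a _; rewrite big_ord0.
rewrite growth_first; have Sij := S_m i j.
(* An edge in the last row and one in the last column, both off the corner, would cross; so one of
   these two arms is empty and can be removed. *)
have [col0|row0] : \sum_(a < i) S a j = 0 \/ \sum_(b < j) S i b = 0.
- case: (posnP (\sum_(b < j) S i b)) => [|pos_row]; [by right | left].
  apply: big1 => a _; apply/eqP; rewrite -leqn0 leqNgt; apply/negP => Saj.
  move: pos_row; rewrite lt0n sum_nat_eq0 negb_forall => /existsP[b] /=.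
  rewrite -lt0n => Sib.
  by have := ncS _ _ _ _ Saj Sib; have := ltn_ord a; have := ltn_ord b; lia.
- rewrite totalSr big_ord_recr /= col0 add0n.
  by have := IHj; lia.
rewrite totalSl big_ord_recr /= row0 add0n.
by have := IHi j.+1; lia.
Qed.

Lemma growth_total m i j : exists S, [/\ forall a b, S a b <= m a b, noncrossing S,
  forall a b, 0 < S a b -> (a < i) && (b < j) & total S i j = growth m i j 0].
Proof.
elim: i j => [|i IHi] j.
  by exists (fun _ _ => 0); split=> //; rewrite /total big_ord0.
elim: j => [|j [S [S_m ncS suppS totS]]].
  by exists (fun _ _ => 0); split=> //; rewrite /total growth0 big1 // => a _; rewrite big_ord0.
have {IHi} [S' [S'_m ncS' suppS' totS']] := IHi j.+1.
suff extend T : (forall a b, T a b <= m a b) -> noncrossing T ->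
    (forall a b, 0 < T a b -> (a <= i) && (b <= j)) -> T i j = 0 ->
    total T i.+1 j.+1 = maxn (growth m i.+1 j 0) (growth m i j.+1 0) ->
  exists T', [/\ forall a b, T' a b <= m a b, noncrossing T',
    forall a b, 0 < T' a b -> (a < i.+1) && (b < j.+1)
    & total T' i.+1 j.+1 = growth m i.+1 j.+1 0].
  have out U p q a b : (forall a b, 0 < U a b -> (a < p) && (b < q)) ->
      p <= a \/ q <= b -> U a b = 0.
    by move=> supp ?; case: (posnP (U a b)) => // /supp; lia.
  case: (leqP (growth m i.+1 j 0) (growth m i j.+1 0)) => [le12|lt21].
    apply: (extend S') => //; first by move=> a b /suppS'; lia.
      by apply: (out _ _ _ _ _ suppS'); left.
    rewrite totalSl totS' big1 ?addn0; first by lia.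
    by move=> b _; apply: (out _ _ _ _ _ suppS'); left.
  apply: (extend S) => //; first by move=> a b /suppS; lia.
    by apply: (out _ _ _ _ _ suppS); right.
  rewrite totalSr totS big1 ?addn0; first by lia.
  by move=> a _; apply: (out _ _ _ _ _ suppS); right.
move=> T_m ncT suppT Tij totT.
exists (fun a b => if (a == i) && (b == j) then m i j else T a b); split.
- by move=> a b; case: andP => [[/eqP-> /eqP->]|].
- move=> a b a' b'; case: andP => [[/eqP-> /eqP->] _|_ Tab];
    case: andP => [[/eqP-> /eqP->] _|_ Tab'].
  + by rewrite !leqnn.
  + by have := suppT _ _ Tab'; lia.
  + by have := suppT _ _ Tab; lia.
  exact: ncT.
- by move=> a b; case: andP => [[/eqP-> /eqP->]|_ /suppT]; lia.
rewrite growth_first -totT /total !big_ord_recr /= !eqxx Tij addn0 -addnA.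
congr (_ + _); last congr (_ + _).
  apply: eq_bigr => a _; rewrite !big_ord_recr /=.
  by rewrite (ltn_eqF (ltn_ord a)); congr (_ + _); apply: eq_bigr => b _; rewrite ltn_eqF.
by apply: eq_bigr => b _; rewrite (ltn_eqF (ltn_ord b)).
Qed.

(** * Chains of partitions as chamber families *)

Section Chains.

Variables n r d : nat.

(** The third clause bounds the number of rows, so the truncated sums in the fourth are the full
    sizes. *)
Definition hchain (la : nat -> nat -> nat) :=
  [/\ la 0 =1 fun=> 0,
      forall i, i < n -> hstrip (la i) (la i.+1),
      forall i k, i <= n -> i <= k -> la i k = 0,
      forall i, i < n -> \sum_(k < n) la i.+1 k = \sum_(k < n) la i k + r
    & forall i k, i <= n -> la i k <= d].

Definition famc (la : nat -> nat -> nat) i : seq {set 'I_d} :=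
  mkseq (fun i => [set c : 'I_d | cj n (la i) c < cj n (la i.+1) c]) i.

Lemma eq_famc la la' : (forall i, i <= n -> la i =1 la' i) -> famc la n = famc la' n.
Proof.
move=> eql; apply/eq_in_map => i; rewrite mem_iota => /= i_n; apply/setP => c.
have eqcj j : j <= n -> cj n (la j) c = cj n (la' j) c.
  by move=> j_n; apply: eq_cj => k _; apply: eql.
by rewrite !inE !eqcj // ltnW.
Qed.

Lemma take_famc la i : i <= n -> take i (famc la n) = famc la i.
Proof. by move=> i_n; rewrite /famc /mkseq -map_take take_iota (minn_idPl i_n). Qed.

(** A strip has at most one cell per column: dropping row 0 of [nu] and shifting up leaves a diagram
    contained in [la]. *)
Lemma cj_hstrip la nu c : hstrip la nu -> cj n la c <= cj n nu c <= (cj n la c).+1.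
Proof.
move=> st; apply/andP; split.
  by apply: leq_sum => k _; have := st k; lia.
case: n => [|n']; first by rewrite /cj big_ord0.
rewrite {1}/cj big_ord_recl /=.
have: \sum_(i < n') (c < nu (bump 0 i)) <= \sum_(i < n') (c < la i).
  by apply: leq_sum => k _; have := st k; rewrite /bump leq0n add1n; lia.
rewrite /cj [in X in _ -> _ <= X]big_ord_recr /=; lia.
Qed.

Lemma hchain_antitone la i : hchain la -> i <= n -> antitone (la i).
Proof.
move=> [la0 st _ _ _]; case: i => [|i] i_n k; first by rewrite !la0.
by have := st i i_n k; have := st i i_n k.+1; lia.
Qed.

(** Each strip lengthens a column by one exactly when its block contains that column; columns from
    [d] on stay empty. *)
Lemma count_famc la i c : hchain la -> i <= n -> count_mem c (wd (famc la i)) = cj n (la i) c.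
Proof.
move=> [la0 st _ _ le_d]; elim: i => [|i IH] i_n.
  by rewrite /cj big1 // => k _; rewrite la0.
rewrite /famc mkseqS count_wd_rcons IH ?(ltnW i_n) //.
have := cj_hstrip c (st i i_n).
have [c_d|d_c] := ltnP c d.
  by rewrite -[X in X \in _]/(val (Ordinal c_d)) mem_blk inE /=; case: ltnP; lia.
rewrite [cj n (la i.+1) c]big1 => [|k _]; first by case: (boolP (c \in _)) => [/blk_lt|]; lia.
by have := le_d i.+1 k i_n; lia.
Qed.

Lemma sum_mem_blk (B : {set 'I_d}) : \sum_(c < d) (val c \in blk B) = #|B|.
Proof.
rewrite -sum1_card [RHS]big_mkcond; apply: eq_bigr => c _.
by rewrite mem_blk; case: (c \in B).
Qed.

Lemma fam_famc la : hchain la -> fam r n (famc la n).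
Proof.
move=> ch; have [_ _ _ sz le_d] := ch; rewrite /fam size_mkseq eqxx; apply/allP => B.
case/mapP => i; rewrite mem_iota => /= i_n ->; set B' := finset _.
have : \sum_(c < d) cj n (la i.+1) c = \sum_(c < d) cj n (la i) c + #|B'|.
  rewrite -sum_mem_blk -big_split /=; apply: eq_bigr => c _.
  rewrite -(count_famc c ch i_n) -(count_famc c ch (ltnW i_n)).
  by rewrite /famc mkseqS count_wd_rcons.
rewrite !sum_cj => [|k|k]; try by apply: le_d; lia.
by rewrite sz // => /addnI/esym/eqP.
Qed.

Lemma chamber_famc la : hchain la -> chamber (famc la n).
Proof.
move=> ch; apply/chamberP => i; have [i_n|n_i] := leqP i n.
  by rewrite take_famc // => c; rewrite !count_famc //; apply: cj_antitone.
rewrite take_oversize ?size_mkseq ?(ltnW n_i) // => c.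
by rewrite !count_famc //; apply: cj_antitone.
Qed.

Lemma famc_inj la la' : hchain la -> hchain la' -> famc la n = famc la' n ->
  forall i, i <= n -> la i =1 la' i.
Proof.
move=> ch ch' eqf i i_n k; have [_ _ z _ le_d] := ch; have [_ _ z' _ le_d'] := ch'.
have zn l : n <= l -> la i l = 0 by move=> n_l; apply: z => //; apply: leq_trans n_l.
have zn' l : n <= l -> la' i l = 0 by move=> n_l; apply: z' => //; apply: leq_trans n_l.
rewrite -(cjK k (hchain_antitone ch i_n) zn (fun l => le_d i l i_n)).
rewrite -(cjK k (hchain_antitone ch' i_n) zn' (fun l => le_d' i l i_n)).
apply: eq_cj => c _; rewrite -(count_famc c ch i_n) -(count_famc c ch' i_n).
by rewrite -(take_famc la i_n) -(take_famc la' i_n) eqf.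
Qed.

(** The inverse of [famc]: the prefix contents are read as column lengths and transposed. *)
Definition shapes (s : seq {set 'I_d}) i := cj d (fun c => count_mem c (wd (take i s))).

Lemma count_take_famS (s : seq {set 'I_d}) i c : i < size s ->
  count_mem c (wd (take i.+1 s)) = count_mem c (wd (take i s)) + (c \in blk (nth set0 s i)).
Proof. by move=> i_s; rewrite (take_nth set0) // count_wd_rcons. Qed.

Lemma hchain_shapes s : fam r n s -> hchain (shapes s).
Proof.
case/andP => /eqP sz_s /allP cs; split=> [k|i i_n k|i k i_n i_k|i i_n|i k _]; last exact: cj_le.
- by rewrite /shapes take0 /cj big1.
- rewrite -sz_s in i_n; apply/andP; split; apply: leq_sum => c _;
    by rewrite count_take_famS //; case: (_ \in _); lia.
- rewrite /shapes /cj big1 // => c _; have := count_wd_size (take i s) c.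
  by rewrite size_take_min; lia.
rewrite -sz_s in i_n; rewrite !sum_cj => [|c|c]; last first.
- by rewrite (leq_trans (count_wd_size _ _)) // size_take_min; lia.
- by rewrite (leq_trans (count_wd_size _ _)) // size_take_min; lia.
under eq_bigr => c _ do rewrite count_take_famS //.
by rewrite big_split /= sum_mem_blk (eqP (cs _ (mem_nth _ i_n))).
Qed.

(** Transposing back recovers the content because the chamber condition makes it weakly
    decreasing. *)
Lemma cj_shapes s i c : fam r n s -> chamber s -> cj n (shapes s i) c = count_mem c (wd (take i s)).
Proof.
case/andP => /eqP sz_s _ /chamberP ch; rewrite /shapes cjK // => [|l d_l|l]; first exact: ch.
  by apply/count_memPn/negP => /wd_lt; lia.
by rewrite (leq_trans (count_wd_size _ _)) // size_take_min; lia.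
Qed.

Lemma famc_shapes s : fam r n s -> chamber s -> famc (shapes s) n = s.
Proof.
move=> F ch; have /andP[/eqP sz_s _] := F.
apply: (@eq_from_nth _ set0); rewrite size_mkseq // => i i_n.
rewrite nth_mkseq //; apply/setP => c; rewrite inE !cj_shapes //.
by rewrite count_take_famS ?sz_s // mem_blk; case: (c \in _); lia.
Qed.

End Chains.

Lemma growth_antitone m i j : antitone (growth m i j).
Proof. by case: j => [|j] k; [rewrite growth0 | have := growth_hstrip_row m i j k; lia]. Qed.

Lemma hchain_growth n r d (m : nat -> nat -> nat) :
    (forall i, i < n -> \sum_(b < n) m i b = r) -> growth m n n 0 <= d ->
  hchain n r d (fun i => growth m i n).
Proof.
move=> row_m le_d; split=> //.
- by move=> i _; apply: growth_hstrip_col.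
- by move=> i k _; apply: growth_support.
- by move=> i i_n; rewrite sum_growth // row_m.
move=> i k i_n; apply: leq_trans le_d.
(* The first row is the longest, and it only grows with [i], so the bound at the far corner controls
   the whole chain. *)
apply: leq_trans (antitone_le (@growth_antitone m i n) (leq0n k)) _.
rewrite -[X in _ <= growth _ X _ _](subnK i_n); elim: (n - i) => // j IHj.
by apply: leq_trans IHj _; case/andP: (growth_hstrip_col m (j + i) n 0).
Qed.

Lemma eq_growth n (m m' : nat -> nat -> nat) : (forall i j, i < n -> j < n -> m i j = m' i j) ->
  forall i j, i <= n -> j <= n -> growth m i j =1 growth m' i j.
Proof.
move=> eqm; elim=> [|i IHi] j i_n j_n //; elim: j j_n => [|j IHj] j_n; first by rewrite !growth0.
rewrite !growthSS => k; rewrite eqm //; apply: eq_local_rule.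
- by apply: IHi; apply: ltnW.
- by apply: IHj; apply: ltnW.
by apply: IHi => //; apply: ltnW.
Qed.

(** * Regular multigraphs and pairs of chamber families *)

Section Matrices.

Variables n r d : nat.
Implicit Type M : 'M['I_r.+1]_n.

Definition ext M (i j : nat) : nat :=
  if insub i is Some a then if insub j is Some b then mult M a b else 0 else 0.

Lemma extE M (a b : 'I_n) : ext M a b = mult M a b.
Proof. by rewrite /ext !valK. Qed.

Lemma ext_gt0 M i j : 0 < ext M i j -> (i < n) && (j < n).
Proof. by rewrite /ext; case: insubP => // a -> _; case: insubP => // b ->. Qed.

Definition of_fun (f : nat -> nat -> nat) : 'M['I_r.+1]_n := \matrix_(i, j) inord (f i j).

Lemma ext_of_fun f i j : (forall a b, a < n -> b < n -> f a b <= r) -> i < n -> j < n ->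
  ext (of_fun f) i j = f i j.
Proof.
move=> f_r i_n j_n; rewrite -[i]/(val (Ordinal i_n)) -[j]/(val (Ordinal j_n)) extE.
by rewrite /mult mxE inordK // ltnS; apply: f_r.
Qed.

Lemma regularP M : reflect
  ((forall i, i < n -> \sum_(b < n) ext M i b = r) /\ (forall j, j < n -> \sum_(a < n) ext M a j = r))
  (regular M).
Proof.
apply: (iffP andP) => [[/forallP rowM /forallP colM]|[rowM colM]].
  split=> i i_n.
    by rewrite -(eqP (rowM (Ordinal i_n))); apply: eq_bigr => b _; rewrite -extE.
  by rewrite -(eqP (colM (Ordinal i_n))); apply: eq_bigr => b _; rewrite -extE.
split; apply/forallP => i; apply/eqP.
  by apply: etrans (rowM i (ltn_ord i)); apply: eq_bigr => b _; rewrite extE.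
by apply: etrans (colM i (ltn_ord i)); apply: eq_bigr => b _; rewrite extE.
Qed.

Lemma nedges_ext M : nedges M = total (ext M) n n.
Proof. by apply: eq_bigr => a _; apply: eq_bigr => b _; rewrite extE. Qed.

Lemma maxplanar_growth M : maxplanar_le d M = (growth (ext M) n n 0 <= d).
Proof.
apply/forallP/idP => [max_d|le_d S].
  have [S [S_M ncS suppS totS]] := growth_total (ext M) n n.
  (* Bounded by the entries of [M], the optimal subgraph can be stored in ['I_r.+1] without loss by
     [inord]. *)
  have S_r a b : a < n -> b < n -> S a b <= r.
    move=> a_n b_n; apply: leq_trans (S_M a b) _.
    by rewrite -[a]/(val (Ordinal a_n)) -[b]/(val (Ordinal b_n)) extE -ltnS; apply: ltn_ord.
  have multS (a b : 'I_n) : mult (of_fun S) a b = S a b by rewrite -extE ext_of_fun.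
  have/implyP := max_d (of_fun S); rewrite nedges_ext -totS.
  have -> : total (ext (of_fun S)) n n = total S n n.
    by apply: eq_bigr => a _; apply: eq_bigr => b _; rewrite ext_of_fun.
  apply; apply/andP; split; first by apply/'forall_forallP => a b; rewrite multS -extE.
  do 4![apply/forallP => ?]; apply/implyP; rewrite !multS => /andP[]; exact: ncS.
apply/implyP => /andP[/'forall_forallP S_M /forallP plS]; rewrite nedges_ext.
apply: leq_trans le_d; apply: total_le_growth => [i j|i j i' j' Sij Sij'].
  have [->//|/ext_gt0/andP[i_n j_n]] := posnP (ext S i j).
  by rewrite -[i]/(val (Ordinal i_n)) -[j]/(val (Ordinal j_n)) !extE; apply: S_M.
have /andP[i_n j_n] := ext_gt0 Sij; have /andP[i'_n j'_n] := ext_gt0 Sij'.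
have/forallP/(_ (Ordinal j_n))/forallP/(_ (Ordinal i'_n))/forallP := plS (Ordinal i_n).
by move/(_ (Ordinal j'_n))/implyP; apply; rewrite -!extE Sij Sij'.
Qed.

(** The chains along the two far sides of the square; the second is read off the transposed
    matrix. *)
Definition growth_pair M : seq {set 'I_d} * seq {set 'I_d} :=
  (famc n d (fun i => growth (ext M) i n) n, famc n d (fun j => growth (fun a b => ext M b a) j n) n).

(** Regularity makes all strips have size [r], and the planar bound confines the chains to [d]
    columns. The two chains share their last partition, which is the equality of contents, and
    [back] inverts the construction. *)
Lemma ghat_good_pairs : ghat r n d = size (good_pairs r n d).
Proof.
rewrite /ghat cardE.
have chains M : M \in enum [set M : 'M['I_r.+1]_n | regular M && maxplanar_le d M] ->
    hchain n r d (fun i => growth (ext M) i n) /\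
    hchain n r d (fun j => growth (fun a b => ext M b a) j n).
  rewrite mem_enum inE maxplanar_growth => /andP[/regularP[rowM colM] le_d].
  by split; apply: hchain_growth => //; rewrite -growthT.
apply: (size_bij (f := growth_pair)).
- exact: enum_uniq.
- exact: uniq_good_pairs.
- move=> M M' /chains[ch1 ch2] /chains[ch1' ch2'] [].
  move=> /(famc_inj ch1 ch1') eq1 /(famc_inj ch2 ch2') eq2.
  apply/matrixP => a b; apply: val_inj; rewrite -[LHS]extE -[RHS]extE.
  apply: (growth_inj (n := n)) => // j j_n k; rewrite growthT [RHS]growthT.
  exact: eq2.
- move=> M /chains[ch1 ch2]; rewrite mem_good_pairs !fam_famc //.
  rewrite (chamber_famc ch1) (chamber_famc ch2); apply/same_contentP => c.
  rewrite (count_famc c ch1 (leqnn n)) (count_famc c ch2 (leqnn n)).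
  by apply: eq_cj => k _; apply: growthT.
move=> [s1 s2]; rewrite mem_good_pairs => /and5P[F1 F2 ch1 ch2 /same_contentP eqc].
pose la := shapes s1; pose mu := shapes s2.
have [la0 la_st _ la_sz _] := hchain_shapes F1; have [mu0 mu_st _ mu_sz _] := hchain_shapes F2.
have lamu : la n =1 mu n.
  move=> k; apply: eq_cj => c _.
  have /andP[/eqP sz1 _] := F1; have /andP[/eqP sz2 _] := F2.
  by rewrite -{1}sz1 -sz2 !take_size.
pose m := back_entry n la mu.
have growth_m i j : i <= n -> j <= n -> growth m i j =1 back n la mu (n - i) (n - j).
  exact: growth_back_entry.
have la_m i : i <= n -> growth m i n =1 la i.
  by move=> i_n k; rewrite growth_m // subnn back0 // subKn.
have mu_m j : j <= n -> growth m n j =1 mu j.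
  by move=> j_n k; rewrite growth_m // subnn /= subKn.
(* By [sum_growth] a row sum is the size of one strip of the chain, which is [r]. *)
have row_m i : i < n -> \sum_(b < n) m i b = r.
  move=> i_n; have := sum_growth m n i_n.
  under eq_bigr => k _ do rewrite la_m //.
  under [X in X + _]eq_bigr => k _ do rewrite (la_m i (ltnW i_n)).
  by rewrite la_sz // => /addnI.
have col_m j : j < n -> \sum_(a < n) m a j = r.
  move=> j_n; have := sum_growth (fun a b => m b a) n j_n.
  under eq_bigr => k _ do rewrite -growthT mu_m //.
  under [X in X + _]eq_bigr => k _ do rewrite -growthT (mu_m j (ltnW j_n)).
  by rewrite mu_sz // => /addnI.
(* An entry is at most its row sum, so the reconstructed matrix fits the finite entry type. *)
have m_r a b : a < n -> b < n -> m a b <= r.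
  by move=> a_n b_n; rewrite -(row_m a a_n) (bigD1 (Ordinal b_n)) //= leq_addr.
have ext_m i j : i < n -> j < n -> ext (of_fun m) i j = m i j by apply: ext_of_fun.
exists (of_fun m).
  rewrite mem_enum inE maxplanar_growth; apply/andP; split.
    apply/regularP; split=> i i_n.
      by rewrite -(row_m i i_n); apply: eq_bigr => b _; apply: ext_m.
    by rewrite -(col_m i i_n); apply: eq_bigr => b _; apply: ext_m.
  by rewrite (eq_growth ext_m) // la_m //; apply: cj_le.
congr (_, _).
  rewrite -[RHS](famc_shapes F1) //; apply: eq_famc => i i_n k.
  by rewrite (eq_growth ext_m) // la_m.
rewrite -[RHS](famc_shapes F2) //; apply: eq_famc => j j_n k.
by rewrite -growthT (eq_growth ext_m) // mu_m.
Qed.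

End Matrices.

Unset Implicit Arguments.

Theorem theorem4 (n r d : nat) (hn : (1 <= n)%N) (hr : (1 <= r)%N) :
  (exists s : seq (seq (seq nat) * seq (seq nat)),
      [/\ uniq s, (forall PQ, PQ \in s = tabpair_ok r n d PQ)
        & size s = ghat r n d])
  /\
  ((ghat r n d)%:Z =
     \sum_(pi : 'S_d) (-1) ^+ (odd_perm pi) * (#|What' r n (Tpi pi)|)%:Z)%R.
Proof.
rewrite ghat_good_pairs; split; first exact: tab_pair_ok.
by rewrite -reflection; apply: eq_bigr => pi _; rewrite card_What.
Qed.
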